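(* Let $q\in L^{1}[0,1]$ be real-valued and let $\lambda_{0}<\lambda_1<\lambda_2<\cdots$ be the eigenvalues of the Neumann boundary value problem $$-y''(x)+q(x)y(x)=\lambda y(x),\qquad x\in[0,1],\qquad y'(0)=y'(1)=0.$$ Then: (a) If $\lambda_{0}\geq \int_{0}^{1}q(x)\,dx$, then $q=\int_{0}^{1}q(x)\,dx$ almost everywhere on $[0,1]$. (b) If $\lambda_{0}\geq 0$ and $\lambda_{n}=(n\pi)^{2}$ for all integers $n>n_{0}$, where $n_{0}$ is a sufficiently large positive integer, then $q=0$ almost everywhere on $[0,1]$.
   Context: The eigenvalues are indexed by $n=0,1,2,\ldots$ in increasing order, so $\lambda_0$ is the first (smallest) eigenvalue; when $q=0$ one has $\lambda_n=(n\pi)^2$ for $n\ge 0$. In (b), the hypothesis on $n_0$ means that the equality $\lambda_n=(n\pi)^2$ holds for all sufficiently large $n$. *)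

(* Defs.v *)
From mathcomp Require Import all_boot all_order all_algebra.
From mathcomp Require Import all_classical all_reals all_analysis.
Import Order.TTheory GRing.Theory Num.Theory.
Import numFieldNormedType.Exports.

Set Implicit Arguments.
Unset Strict Implicit.
Unset Printing Implicit Defensive.

Local Open Scope classical_set_scope.
Local Open Scope ring_scope.

(* One-sided at the endpoints when [A] is a closed interval. *)
Definition has_derivative_in (R : realType) (A : set R) (f : R -> R)
    (x l : R) : Prop :=
  (f z - f x) / (z - x) @[z --> within A x^'] --> l.

Definition abs_continuous (R : realType) (a b : R) (f : R -> R) : Prop :=
  forall e : R, 0 < e -> exists2 d : R, 0 < d &
    forall (n : nat) (u v : 'I_n -> R),
      (forall i, [/\ a <= u i, u i <= v i & v i <= b]) ->
      trivIset setT (fun i => `]u i, v i[%classic) ->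
      \sum_(i < n) (v i - u i) < d ->
      \sum_(i < n) `|f (v i) - f (u i)| < e.

(* As [q] is merely integrable, a solution is a function [y], differentiable
   on [0, 1], whose derivative [dy] is absolutely continuous (so that [y] is
   C^1, hence absolutely continuous too) and which satisfies the differential
   equation almost everywhere. The values of [y] outside [0, 1] are
   irrelevant. *)
Definition neumann_solution (R : realType) (q : R -> R) (lam : R)
    (y : R -> R) : Prop :=
  exists dy ddy : R -> R,
  [/\ forall x, x \in `[0, 1] -> has_derivative_in `[0, 1] y x (dy x),
      abs_continuous 0 1 dy,
      {ae (@lebesgue_measure R), forall x, x \in `[0, 1] ->
         has_derivative_in `[0, 1] dy x (ddy x) /\
         - ddy x + q x * y x = lam * y x},
      dy 0 = 0 &
      dy 1 = 0].

(* The problem is self-adjoint, so that all eigenvalues are real and have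
   real-valued eigenfunctions. *)
Definition neumann_eigenvalue (R : realType) (q : R -> R) (lam : R) : Prop :=
  exists2 y : R -> R, neumann_solution q lam y &
    exists2 x, x \in `[0, 1] & y x != 0.

(* Main.v *)
Require Import Defs.
From mathcomp Require Import all_boot all_order all_algebra.
From mathcomp Require Import all_classical all_reals all_analysis.
From mathcomp Require Import measurable_realfun.
From mathcomp Require Import ring lra.
Import Order.TTheory GRing.Theory Num.Theory.
Import numFieldNormedType.Exports.

Set Implicit Arguments.
Unset Strict Implicit.
Unset Printing Implicit Defensive.

Local Open Scope classical_set_scope.
Local Open Scope ring_scope.

(** The potential q is only integrable, so the first half of the proof works
    with its primitive Q x = int_0^x q and, for a solution y, with the
    quasi-derivative W = y' - Q y. The equation - y'' + q y = l y becomes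
      y' = W + Q y,    W' = - (l + Q ^ 2) y - Q W,
    a linear system with continuous coefficients, whose solutions exist by
    Picard iteration ([linear_system]) and depend continuously on l
    ([quasi_solution_lipschitz]).

    (a) Solve from y(0) = 1, y'(0) = 0, and let m = Q 1 be the mean of q. When l
    is very negative, y > 0 on [0, 1] and y'(1) > 0
    ([quasi_solution_very_negative]). As long as y > 0, the quotient v = W / y
    satisfies the Riccati equation v' = - l - (y' / y) ^ 2, so that
      y'(1) / y(1) = m - l - int_0^1 (y' / y) ^ 2,
    which is at most 0 when l = m. Hence the smaller of min y and y'(1), a
    continuous function of l, vanishes for some l <= m. There min y is not 0,
    since a zero of y that is a minimum would be a double zero; so y'(1) = 0
    and y is a positive eigenfunction ([positive_eigenfunction]). If no
    eigenvalue is below m, then l = m, the integral above vanishes, y is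
    constant, and q = m almost everywhere ([eigenvalues_ge_mean_cst]).

    (b) Suppose that k ^ 2 is an eigenvalue with k = n pi. Variation of constants
    shows that an eigenfunction differs from y(0) cos (k x) by O(|y(0)| / k),
    and the condition at 1 says that q y cos (k x) has integral 0; so
    int_0^1 q cos ^ 2 (n pi x) = O(1 / n) ([neumann_cos_sq_le]). The averages
    over n of cos ^ 2 (n pi x) converge boundedly to 1 / 2 on ]0, 1[, and
    dominated convergence gives int_0^1 q = 0 ([mean_potential_eq0]). Then (a)
    applies because lam 0 >= 0.

    Two facts carry the passage between q and its primitive: the primitive is
    differentiable with derivative q almost everywhere, and an absolutely
    continuous function is the integral of its almost everywhere derivative
    ([abs_continuous_FTC]). *)

(** * Derivatives through their error bounds *)

Section Derivatives.
Context {R : realType}.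
Implicit Types (f g : R -> R) (A : set R) (a b x l : R).

(** A form without quotients, in which the point z = x need not be excluded. *)
Lemma has_derivative_in_approxP A f x l : has_derivative_in A f x l <->
  forall e : R, 0 < e -> exists2 r : R, 0 < r & forall z, A z -> `|z - x| < r ->
    `|f z - f x - l * (z - x)| <= e * `|z - x|.
Proof.
have key z e : z != x ->
    (`|l - (f z - f x) / (z - x)| <= e) =
    (`|f z - f x - l * (z - x)| <= e * `|z - x|).
  move=> zx; have zx0 : z - x != 0 by rewrite subr_eq0.
  rewrite -ler_pdivrMr ?normr_gt0// -normfV -normrM distrC.
  by congr (`|_| <= _); field.
split.
- move=> /cvgrPdist_le fxl e e0; have := fxl e e0.
  rewrite !near_withinE/= near_simpl => /nbhs_ballP[r/= r0 H].
  exists r => // z Az zr; have [->|zx] := eqVneq z x.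
    by rewrite !subrr mulr0 subrr normr0 mulr0.
  by rewrite -key//; apply: H => //; rewrite /ball/= distrC.
- move=> H; apply/cvgrPdist_le => e /H[r r0 {}H].
  rewrite !near_withinE/= near_simpl; apply/nbhs_ballP; exists r => // z.
  rewrite /ball/= distrC => zr zx Az.
  by rewrite key//; exact: H.
Qed.

Lemma is_derive_approxP f x l : is_derive x 1 f l <->
  forall e : R, 0 < e -> exists2 r : R, 0 < r & forall z, `|z - x| < r ->
    `|f z - f x - l * (z - x)| <= e * `|z - x|.
Proof.
have key h : h != 0 ->
    `|l - h^-1 *: (f (h *: 1 + x) - f x)| * `|h| =
    `|f (h + x) - f x - l * h|.
  move=> h0; rewrite [h *: 1]mulr1 -[_ *: _]/(_ * _) -normrM distrC.
  by congr (`|_|); field.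
split.
- move=> [df dfl] e e0.
  have /cvgrPdist_le/(_ _ e0) : h^-1 *: (f (h *: 1 + x) - f x) @[h --> 0^'] --> l.
    by rewrite -dfl.
  rewrite near_withinE/= near_simpl => /nbhs_ballP[r/= r0 H].
  exists r => // z zr; have [->|zx] := eqVneq z x.
    by rewrite !subrr mulr0 subrr normr0 mulr0.
  have zx0 : z - x != 0 by rewrite subr_eq0.
  have := H (z - x); rewrite /ball/= sub0r normrN => /(_ zr zx0).
  by rewrite -(@ler_pM2r _ `|z - x|) ?normr_gt0// key// subrK.
- move=> H.
  have cl : h^-1 *: (f (h *: 1 + x) - f x) @[h --> 0^'] --> l.
    apply/cvgrPdist_le => e /H[r r0 {}H].
    rewrite !near_withinE/= near_simpl; apply/nbhs_ballP; exists r => // z.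
    rewrite /ball/= sub0r normrN => zr zx.
    have := H (z + x); rewrite addrK => /(_ zr).
    by rewrite -key// ler_pM2r ?normr_gt0.
  apply: DeriveDef; first by apply/cvg_ex; exists l.
  by apply/cvg_lim.
Qed.

Lemma is_derive_has_derivative_in A f x l :
  is_derive x 1 f l -> has_derivative_in A f x l.
Proof.
move=> /is_derive_approxP H; apply/has_derivative_in_approxP => e /H[r r0 {}H].
by exists r => // z _; exact: H.
Qed.

Lemma has_derivative_in_is_derive a b f x l : a < x -> x < b ->
  has_derivative_in `[a, b] f x l -> is_derive x 1 f l.
Proof.
move=> ax xb /has_derivative_in_approxP H; apply/is_derive_approxP => e /H[r r0 {}H].
exists (Num.min r (Num.min (x - a) (b - x))).
  by rewrite !lt_min r0 !subr_gt0 ax xb.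
move=> z; rewrite !lt_min => /and3P[zr]; rewrite ltr_norml => /andP[za _].
move=> /ltr_normlP[_ zb]; apply: H => //=.
by rewrite in_itv/=; apply/andP; split; lra.
Qed.

Lemma is_derive_eq_near f g x l (r : R) : 0 < r ->
  (forall z, `|z - x| < r -> f z = g z) -> is_derive x 1 f l -> is_derive x 1 g l.
Proof.
move=> r0 fg /is_derive_approxP H; apply/is_derive_approxP => e /H[s s0 {}H].
exists (Num.min r s); first by rewrite lt_min r0.
move=> z; rewrite lt_min => /andP[zr zs].
by rewrite -!fg ?subrr ?normr0//; exact: H.
Qed.

Lemma has_derivative_in_continuous A f dfun :
  (forall x, A x -> has_derivative_in A f x (dfun x)) -> {within A, continuous f}.
Proof.
move=> df; apply/subspace_continuousP => x Ax.
apply/cvgrPdist_le => e e0.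
have /has_derivative_in_approxP/(_ _ ltr01)[r r0 H] := df _ Ax.
rewrite near_withinE; apply/nbhs_ballP.
have K0 : 0 < 1 + `|dfun x| by rewrite ltr_pwDl.
exists (Num.min r (e / (1 + `|dfun x|))) => /=.
  by rewrite lt_min r0 divr_gt0.
move=> z; rewrite /ball/= lt_min distrC => /andP[zr ze] Az.
have := H _ Az zr; rewrite mul1r => fz.
rewrite distrC -[f z - f x](subrK (dfun x * (z - x))).
rewrite (le_trans (ler_normD _ _))// normrM.
apply: (@le_trans _ _ ((1 + `|dfun x|) * `|z - x|)).
  by rewrite mulrDl mul1r lerD2r.
by rewrite mulrC -ler_pdivlMr// ltW.
Qed.

Lemma continuous_bounded a b f : a <= b -> {within `[a, b], continuous f} ->
  exists2 M : R, 0 <= M & forall x, a <= x -> x <= b -> `|f x| <= M.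
Proof.
move=> ab cf.
have [c _ Hc] := EVT_max ab cf; have [d _ Hd] := EVT_min ab cf.
exists (`|f c| + `|f d|); first by rewrite addr_ge0.
move=> x ax xb; have xab : x \in `[a, b] by rewrite in_itv/= ax.
have := Hc _ xab; have := Hd _ xab.
have := ler_norm (f c); have := ler_norm (- f d); rewrite normrN => ? ? ? ?.
by rewrite ler_norml; have := normr_ge0 (f c); have := normr_ge0 (f d); lra.
Qed.

End Derivatives.

(** * Absolutely continuous functions *)

Section AbsolutelyContinuous.
Context {R : realType}.
Implicit Types (f g : R -> R) (a b x : R).
Local Notation mu := (@lebesgue_measure R).

Lemma lipschitz_abs_continuous a b f (L : R) :
  (forall x y, a <= x -> x <= y -> y <= b -> `|f y - f x| <= L * (y - x)) ->
  abs_continuous a b f.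
Proof.
move=> fL e e0; have K0 : 0 < `|L| + 1 by rewrite ltr_wpDl.
exists (e / (`|L| + 1)); first by rewrite divr_gt0.
move=> n u v uv _; rewrite ltr_pdivlMr// => uvd.
apply: le_lt_trans uvd; rewrite mulr_suml; apply: ler_sum => i _.
have [au uvi vb] := uv i; apply: (le_trans (fL _ _ au uvi vb)).
rewrite mulrC ler_wpM2l ?subr_ge0// (le_trans (ler_norm _))// lerDl.
by [].
Qed.

Lemma abs_continuousD a b f g :
  abs_continuous a b f -> abs_continuous a b g ->
  abs_continuous a b (fun x => f x + g x).
Proof.
move=> fa ga e e0; have e20 : 0 < e / 2 by rewrite divr_gt0.
have [d d0 fd] := fa _ e20; have [d' d'0 gd] := ga _ e20.
exists (Num.min d d'); first by rewrite lt_min d0.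
move=> n u v uv tuv; rewrite lt_min => /andP[ud ud'].
rewrite [e]splitr; apply: le_lt_trans (ltrD (fd _ _ _ uv tuv ud) (gd _ _ _ uv tuv ud')).
rewrite -big_split/=; apply: ler_sum => i _.
by rewrite opprD addrACA ler_normD.
Qed.

Lemma abs_continuousM a b f g (M : R) :
  (forall x, a <= x -> x <= b -> `|f x| <= M) ->
  (forall x, a <= x -> x <= b -> `|g x| <= M) ->
  abs_continuous a b f -> abs_continuous a b g ->
  abs_continuous a b (fun x => f x * g x).
Proof.
move=> fM gM fa ga e e0; have K0 : 0 < `|M| + 1 by rewrite ltr_wpDl.
have e20 : 0 < e / 2 / (`|M| + 1) by rewrite !divr_gt0.
have [d d0 fd] := fa _ e20; have [d' d'0 gd] := ga _ e20.
exists (Num.min d d'); first by rewrite lt_min d0.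
move=> n u v uv tuv; rewrite lt_min => /andP[ud ud'].
have := ltrD (fd _ _ _ uv tuv ud) (gd _ _ _ uv tuv ud').
rewrite -mulrDl -splitr ltr_pdivlMr//; apply: le_lt_trans.
rewrite -big_split/= mulr_suml; apply: ler_sum => i _.
have [au uvi vb] := uv i.
rewrite (_ : _ - _ =
  (f (v i) - f (u i)) * g (v i) + f (u i) * (g (v i) - g (u i))); last by ring.
rewrite (le_trans (ler_normD _ _))// !normrM mulrDl lerD//.
  rewrite ler_wpM2l// (le_trans (gM _ _ _))//; first exact: le_trans uvi.
  by rewrite (le_trans (ler_norm _))// lerDl.
rewrite mulrC ler_wpM2l// (le_trans (fM _ _ _))//; first exact: le_trans vb.
by rewrite (le_trans (ler_norm _))// lerDl.
Qed.

Lemma abs_continuous_sub a b c f : c <= b ->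
  abs_continuous a b f -> abs_continuous a c f.
Proof.
move=> cb fa e e0; have [d d0 fd] := fa _ e0; exists d => // n u v uv.
by apply: fd => i; have [? ? vc] := uv i; split=> //; exact: le_trans cb.
Qed.

(** Compactness of [a, b] in the form of Cousin's lemma: a property that can be
    carried across each point x, from any nearby s on its left to any nearby t on
    its right, reaches b. Every step is tagged by the point x that it crosses, which is
    what a pointwise derivative can control. *)
Lemma real_induction (P : R -> Prop) a b : a <= b -> P a ->
  (forall x, a <= x -> x <= b -> exists2 r : R, 0 < r &
     forall s t, a <= s -> s <= x -> x <= t -> t <= b ->
       x - r < s -> t < x + r -> P s -> P t) -> P b.
Proof.
move=> ab Pa step.
pose S := [set c | [/\ a <= c, c <= b & P c]].
have Sa : S a by split.
have Sb : ubound S b by move=> c [].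
have supS : has_sup S by split; [exists a | exists b].
have ax : a <= sup S by apply: ub_le_sup => //; exists b.
have xb : sup S <= b by apply: ge_sup => //; exists a.
have [r r0 H] := step _ ax xb.
have [s [as_ sb Ps] xrs] := sup_adherent r0 supS.
have sx : s <= sup S by apply: ub_le_sup; [exists b|].
have Q t : sup S <= t -> t <= b -> t < sup S + r -> P t.
  by move=> xt tb tr; apply: (H s t).
have [xrb|bxr] := ltP (sup S + r / 2) b; last first.
  apply: Q => //; apply: le_lt_trans bxr _.
  by rewrite ltrD2l ltr_pdivrMr// ltr_pMr// ltr1n.
have : S (sup S + r / 2).
  split; [|exact: ltW|apply: Q; last 2 first].
  - by rewrite (le_trans ax)// lerDl divr_ge0// ltW.
  - exact: ltW.
  - by rewrite ltrD2l ltr_pdivrMr// ltr_pMr// ltr1n.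
  - by rewrite lerDl divr_ge0// ltW.
move=> /(ub_le_sup (ex_intro _ b Sb)).
by rewrite leNgt ltrDl divr_gt0.
Qed.

(** By outer regularity, the points where P fails, together with the
    endpoints, lie in an open set of small measure. *)
Lemma ae_null_neighborhood a b (P : R -> Prop) (d : R) : 0 < d ->
  {ae mu, forall x, a < x -> x < b -> P x} ->
  exists U : set R, [/\ open U, (mu U < d%:E)%E &
    forall x, a <= x -> x <= b -> ~ U x -> [/\ a < x, x < b & P x]].
Proof.
move=> d0 [A [mA A0 PA]].
pose D := A `|` [set a] `|` [set b].
have mD : measurable D by do 2! (apply: measurableU => //).
have D0 : mu D = 0%E.
  have A1 : mu (A `|` [set a]) = 0%E.
    by rewrite null_set_setU//; exact: lebesgue_measure_set1.
  apply: null_set_setU => //; first exact: measurableU.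
  exact: lebesgue_measure_set1.
have Dfin : (mu D < +oo)%E by rewrite D0 ltry.
have [U [oU DU Ud]] := lebesgue_regularity_outer mD Dfin d0.
have mU : measurable U by exact: open_measurable.
exists U; split => //.
  have <- : (U `\` D) `|` D = U by rewrite setUC setDUK.
  apply: le_lt_trans (measureU2 _ _ _) _ => //; first exact: measurableD.
  by rewrite [X in (_ + X < _)%E]D0 adde0.
move=> x ax xb Ux.
have xa : a < x.
  rewrite lt_neqAle ax andbT; apply/eqP => ae; apply: Ux; apply: DU.
  by rewrite -ae; left; right.
have bx : x < b.
  rewrite lt_neqAle xb andbT; apply/eqP => ae; apply: Ux; apply: DU.
  by rewrite ae; right.
split => //; apply: contrapT => nP; apply: Ux; apply: DU; left; left.
by apply: PA => /(_ xa bx).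
Qed.

(** Outside an open set U of small measure the derivative vanishes, so a step
    tagged by such a point changes f by at most e times its length. The steps
    tagged by points of U lie in U; their total length is below the modulus of
    absolute continuity, so together they change f by at most e. *)
Lemma abs_continuous_cst a b f : a <= b -> abs_continuous a b f ->
  {ae mu, forall x, a < x -> x < b -> is_derive x 1 f 0} -> f b = f a.
Proof.
move=> ab fa df; apply/eqP; rewrite -subr_eq0 -normr_le0.
apply/ler_addgt0Pr => _ /posnumP[e0]; rewrite add0r.
pose e := e0%:num / (b - a + 1).
have ba0 : 0 < b - a + 1 by rewrite ltr_wpDl// subr_ge0.
have e_gt0 : 0 < e by rewrite divr_gt0.
have [d d_gt0 fd] := fa _ e_gt0.
have [U [oU Ud Uout]] := ae_null_neighborhood d_gt0 df.
have mU : measurable U by exact: open_measurable.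
have mUI c : measurable (U `&` `[a, c]) by exact: measurableI.
(* The invariant keeps the steps tagged in U as an ordered family of intervals.
   Comparing their total length with the measure of the part of U on the left
   of c makes it easy to add one more interval. *)
pose P c := exists n (u v : nat -> R), [/\
  forall i, (i < n)%N -> [/\ a <= u i, u i <= v i & v i <= c],
  forall i j, (i < j)%N -> (j < n)%N -> v i <= u j,
  ((\sum_(i < n) (v i - u i))%:E <= mu (U `&` `[a, c]))%E &
  `|f c - f a| <= e * (c - a) + \sum_(i < n) `|f (v i) - f (u i)|].
have : P b.
  apply: (@real_induction P a b) => //.
    exists 0, (fun=> a), (fun=> a); split => //.
      by rewrite big_ord0 measure_ge0.
    by rewrite big_ord0 !subrr mulr0 normr0 addr0.
  move=> x ax xb; have [Ux|Ux] := pselect (U x).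
    have /nbhs_ballP[r/= r0 xrU] := open_nbhs_nbhs (conj oU Ux).
    exists r => // s t as_ sx xt tb xrs txr [n [u [v [uv sep suv fs]]]].
    have st : s <= t by exact: le_trans xt.
    have stU : `]s, t] `<=` U.
      move=> z/=; rewrite in_itv/= => /andP[sz zt]; apply: xrU.
      by rewrite /ball/= ltr_distlC (lt_trans xrs sz) (le_lt_trans zt).
    exists n.+1, (fun i => if i == n then s else u i),
      (fun i => if i == n then t else v i); split.
    - move=> i; rewrite ltnS leq_eqVlt => /predU1P[->|ni]; first by rewrite eqxx.
      have [? ? vs] := uv i ni.
      by rewrite ltn_eqF//; split=> //; exact: le_trans st.
    - move=> i j ij; rewrite ltnS leq_eqVlt => /predU1P[jn|jn].
        rewrite jn eqxx; have ni : (i < n)%N by rewrite -jn.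
        by rewrite ltn_eqF//; have [] := uv i ni.
      have ni : (i < n)%N by exact: ltn_trans jn.
      by rewrite !ltn_eqF// sep.
    - rewrite big_ord_recr/= eqxx.
      under eq_bigr do rewrite ltn_eqF//.
      rewrite EFinD.
      apply: (@le_trans _ _ (mu (U `&` `[a, s]) + mu `]s, t])%E).
        apply: leeD => //; rewrite lebesgue_measure_itv/= lte_fin.
        by case: ltP => // ts; rewrite lee_fin subr_le0.
      have dis : U `&` `[a, s] `&` `]s, t] = set0.
        rewrite -subset0 => z [[_]/=]; rewrite !in_itv/= => /andP[_ zs] /andP[sz _].
        by move: sz; rewrite ltNge zs.
      have mst : measurable (`]s, t] : set R) by exact: measurable_itv.
      have <- := measureU mu (mUI s) mst dis.
      have mUst := measurableU _ _ (mUI s) mst.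
      apply: le_measure; rewrite ?inE//; first exact: mUI.
      move=> z [[Uz]/=|/=]; rewrite !in_itv/= => /andP[].
        by move=> az zs; split => //; apply/andP; split => //; exact: le_trans st.
      move=> sz zt; split; first by apply: stU; apply/andP.
      by apply/andP; split => //; rewrite (le_trans as_)// ltW.
    - rewrite big_ord_recr/= eqxx.
      under eq_bigr do rewrite ltn_eqF//.
      have -> : f t - f a = (f s - f a) + (f t - f s) by ring.
      rewrite (le_trans (ler_normD _ _))// addrA lerD2r (le_trans fs)//.
      by rewrite lerD2r ler_wpM2l ?lerD2r// ltW.
  have [ax' xb' dfx] := Uout _ ax xb Ux.
  have [r r0 H] := (is_derive_approxP _ _ _).1 dfx _ e_gt0.
  exists r => // s t as_ sx xt tb xrs txr [n [u [v [uv sep suv fs]]]].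
  have st : s <= t by exact: le_trans xt.
  exists n, u, v; split => //.
  - by move=> i /uv[? ? vs]; split=> //; exact: le_trans st.
  - apply: (le_trans suv); apply: le_measure; rewrite ?inE; [exact: mUI..|].
    apply: setIS => z/=; rewrite !in_itv/= => /andP[-> zs].
    by rewrite (le_trans zs).
  - have -> : f t - f a = (f s - f a) + ((f t - f x) - (f s - f x)) by ring.
    rewrite (le_trans (ler_normD _ _))//.
    have := H t; rewrite mul0r subr0 ger0_norm ?subr_ge0// ltrBlDl => /(_ txr) ft.
    have := H s; rewrite mul0r subr0 distrC ger0_norm ?subr_ge0//.
    rewrite ltrBlDl -ltrBlDr => /(_ xrs) fs'.
    have := ler_normB (f t - f x) (f s - f x).
    by lra.
move=> [n [u [v [uv sep suv fb]]]].
have : \sum_(i < n) `|f (v i) - f (u i)| < e.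
  apply: fd => [i||].
  - by have [] := uv i (ltn_ord i).
  - apply/trivIsetP => /= i j _ _ ij.
    wlog lij : i j ij / (i < j)%N.
      move=> H; have [|] := ltnP i j; first exact: H.
      rewrite leq_eqVlt => /predU1P[|ji]; last first.
        by rewrite setIC; apply: H => //; rewrite eq_sym.
      by move=> ji; move: ij; rewrite -val_eqE/= ji eqxx.
    have vu := sep _ _ lij (ltn_ord j).
    rewrite -subset0 => z []/=; rewrite !in_itv/= => /andP[_ zv] /andP[uz _].
    by have := lt_trans (lt_le_trans zv vu) uz; rewrite ltxx.
  - rewrite -lte_fin; apply: le_lt_trans suv _; apply: le_lt_trans Ud.
    by apply: le_measure; rewrite ?inE; [exact: mUI|exact: mU|move=> z []].
move=> sume; apply: (le_trans fb); apply: (@le_trans _ _ (e * (b - a) + e)).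
  by rewrite lerD2l ltW.
by rewrite -[X in _ + X]mulr1 -mulrDr /e divfK// gt_eqF.
Qed.

Lemma abs_continuous_continuous a b f : abs_continuous a b f ->
  {within `[a, b], continuous f}.
Proof.
move=> fa; apply/subspace_continuousP => x /=.
rewrite in_itv/= => /andP[ax xb]; apply/cvgrPdist_lt => e e0.
have [d d0 H] := fa e e0.
rewrite near_withinE; apply/nbhs_ballP; exists d => //= z.
rewrite /ball/= => zd; rewrite in_itv/= => /andP[az zb].
have key u v : a <= u -> u <= v -> v <= b -> v - u < d -> `|f v - f u| < e.
  move=> au uv vb uvd.
  have := H 1%N (fun=> u) (fun=> v); rewrite !big_ord1; apply => //.
  by apply/trivIsetP => i j _ _; rewrite !ord1 eqxx.
have [xz|zx] := leP x z.
  by rewrite distrC key//; move: zd => /ltr_normlP[]; lra.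
by rewrite key//; [exact: ltW|move: zd => /ltr_normlP[]; lra].
Qed.

End AbsolutelyContinuous.

(** * Primitives of integrable functions *)

Section Primitive.
Context {R : realType}.
Implicit Types (f g q : R -> R) (a b x : R).
Local Notation mu := (@lebesgue_measure R).

Lemma Rintegral_itv_diff q a b u v : a <= u -> u <= v -> v <= b ->
  mu.-integrable `[a, b] (EFin \o q) ->
  \int[mu]_(x in `[a, v]) q x - \int[mu]_(x in `[a, u]) q x =
  \int[mu]_(x in `]u, v]) q x.
Proof.
move=> au uv vb qi; apply: Rintegral_itvB; rewrite ?bnd_simp//.
apply: integrableS qi => //; apply: subset_itvl; rewrite bnd_simp//.
Qed.

(** The total variation over disjoint intervals is at most the integral of |q|
    over their union, a set of small measure. *)
Lemma abs_continuous_primitive q a b :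
  mu.-integrable `[a, b] (EFin \o q) ->
  abs_continuous a b (fun x => \int[mu]_(t in `[a, x]) q t).
Proof.
move=> qi e e0.
pose p := q \_ `[a, b].
have pi' : mu.-integrable setT (EFin \o p).
  by rewrite /p -restrict_EFin; apply/integrable_restrict => //=; rewrite setTI.
have [d [d0 H]] := integral_normr_continuous pi' e0.
exists d => // n u v uv tuv suv.
pose A := \big[setU/set0]_(i < n) `]u i, v i[%classic.
have mF i : measurable (`]u i, v i[%classic : set R) by exact: measurable_itv.
have mA : measurable A by apply: bigsetU_measurable => i _; exact: measurable_itv.
have muF i : mu `]u i, v i[ = (v i - u i)%:E.
  have [_ uvi _] := uv i; rewrite lebesgue_measure_itv/= lte_fin.
  case: ltP => // vu; rewrite (_ : v i = u i) ?subrr//.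
  by apply/eqP; rewrite eq_le vu.
have muA : (mu A < d%:E)%E.
  rewrite /A measure_bigsetU_ord//.
  rewrite (eq_bigr (fun i => (v i - u i)%:E)) ?sumEFin ?lte_fin// => i _.
  exact: muF.
apply: le_lt_trans (H _ mA muA).
have pin B : measurable B -> mu.-integrable B (EFin \o (fun x => `|p x|)).
  move=> mB; have /integrable_norm := integrableS measurableT mB (@subsetT _ B) pi'.
  by apply: eq_integrable => // x _.
rewrite -lee_fin fineK; last first.
  by apply: integrable_fin_num => //; exact: pin.
rewrite /A ge0_integral_bigsetU//; last 3 first.
- exact: index_enum_uniq.
- exact: sub_trivIset tuv.
- apply/measurable_EFinP.
  have /integrableP[/measurable_EFinP + _] := pin _ mA.
  exact.
rewrite -sumEFin; apply: lee_sum => i _.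
have [au uvi vb] := uv i.
rewrite (Rintegral_itv_diff au uvi vb qi).
have qiuv : mu.-integrable `]u i, v i] (EFin \o q).
  apply: integrableS qi => //; apply: subset_itv; rewrite bnd_simp//.
apply: (@le_trans _ _ (\int[mu]_(t in `]u i, v i]) `|q t|)%:E).
  by rewrite lee_fin; exact: le_normr_Rintegral.
rewrite -Rintegral_itv_bndo_bndc; last first.
  by apply: integrableS (integrable_norm qiuv) => //; exact: subset_itvW.
have -> : \int[mu]_(t in `]u i, v i[) `|q t| = \int[mu]_(t in `]u i, v i[) `|p t|.
  apply: eq_Rintegral => x; rewrite inE/= in_itv/= => /andP[ux xv].
  rewrite /p patchE mem_set//= in_itv/= (le_trans au (ltW ux)).
  by rewrite (le_trans (ltW xv)).
by rewrite fineK//; apply: integrable_fin_num => //; exact: pin.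
Qed.

(** Lebesgue's differentiation theorem, for a function that is integrable on
    [a, b] only. *)
Lemma primitive_ae_derive q a b :
  mu.-integrable `[a, b] (EFin \o q) ->
  {ae mu, forall x, a < x -> x < b ->
    is_derive x 1 (fun x => \int[mu]_(t in `[a, x]) q t) (q x)}.
Proof.
move=> qi.
pose p := q \_ `[a, b].
have pi' : mu.-integrable `[a, b] (EFin \o p).
  by rewrite /p -restrict_EFin; apply/integrable_restrict => //=; rewrite setIid.
have /lebesgue_differentiation : locally_integrable setT p.
  exact: integrable_locally.
apply: filterS; first exact: (ae_filter_ringOfSetsType mu).
move=> x px ax xb.
have [|df fx] := @FTC1_lebesgue_pt _ p (BLeft a) x b xb pi' _ px.
  by rewrite lte_fin.
have pq : p x = q x by rewrite /p patchE mem_set//= in_itv/= !ltW.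
have : is_derive x 1 (fun y => \int[mu]_(t in `[a, y]) p t) (q x).
  by rewrite -pq -fx derive1E; exact/derivableP.
apply: (@is_derive_eq_near _ _ _ _ _ (b - x)); first by rewrite subr_gt0.
move=> z /ltr_normlP[_]; rewrite ltrD2r => zb.
apply: eq_Rintegral => y; rewrite inE/= in_itv/= => /andP[ay yz].
by rewrite /p patchE mem_set//= in_itv/= ay (le_trans yz)// ltW.
Qed.

(** The difference of f and of the primitive of h is absolutely continuous with
    zero derivative almost everywhere. *)
Lemma abs_continuous_FTC f h a b : a <= b -> abs_continuous a b f ->
  mu.-integrable `[a, b] (EFin \o h) ->
  {ae mu, forall x, a < x -> x < b -> is_derive x 1 f (h x)} ->
  forall x, a <= x -> x <= b -> f x = f a + \int[mu]_(t in `[a, x]) h t.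
Proof.
move=> ab fa hi df x ax xb.
pose F x := \int[mu]_(t in `[a, x]) h t.
have Fa0 : F a = 0 by rewrite /F set_itv1 Rintegral_set1.
suff : (f x - F x) = (f a - F a) by rewrite Fa0 subr0 => <-; rewrite subrK.
apply: (@abs_continuous_cst _ _ _ (fun x => f x - F x)) => //.
  apply: (abs_continuous_sub xb); apply: abs_continuousD => //.
  have -> : (fun x => - F x) = (fun x => (-1) * F x) by apply/funext => y; rewrite mulN1r.
  have Fac := abs_continuous_primitive hi.
  have [M M0 FM] := continuous_bounded ab (abs_continuous_continuous Fac).
  apply: (@abs_continuousM _ _ _ _ _ (1 + M)) => //.
  - by move=> *; rewrite normrN1 lerDl.
  - by move=> z az zb; rewrite (le_trans (FM z az zb))// lerDr.
  - apply: (@lipschitz_abs_continuous _ _ _ _ 0) => *.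
    by rewrite subrr normr0 mul0r.
have := primitive_ae_derive hi.
move: df; apply: filterS2; first exact: (ae_filter_ringOfSetsType mu).
move=> z dfz dFz az zx.
have zb : z < b by exact: lt_le_trans xb.
have := dfz az zb; have := dFz az zb => dF dfz'.
rewrite -[0](subrr (h z)).
exact: is_deriveB.
Qed.

End Primitive.

(** * Differential inequalities on real intervals *)

Section Calculus.
Context {R : realType}.
Implicit Types (f g : R -> R) (x : R).
Local Notation mu := (@lebesgue_measure R).

(** The rules of differentiation, restated for explicit [fun t => _] bodies:
    this is the shape of the functions differentiated below, and each rule
    then computes the derivative together with its proof. *)
Lemma derD f g x (l m : R) : is_derive x 1 f l -> is_derive x 1 g m ->
  is_derive x 1 (fun t => f t + g t) (l + m).
Proof. exact: is_deriveD. Qed.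

Lemma derB f g x (l m : R) : is_derive x 1 f l -> is_derive x 1 g m ->
  is_derive x 1 (fun t => f t - g t) (l - m).
Proof. exact: is_deriveB. Qed.

Lemma derN f x (l : R) : is_derive x 1 f l ->
  is_derive x 1 (fun t => - f t) (- l).
Proof. exact: is_deriveN. Qed.

Lemma derM f g x (l m : R) : is_derive x 1 f l -> is_derive x 1 g m ->
  is_derive x 1 (fun t => f t * g t) (l * g x + f x * m).
Proof.
by move=> fl gm; apply: (is_derive_eq (is_deriveM fl gm)); rewrite addrC mulrC.
Qed.

Lemma der_cst (c : R) x : is_derive x 1 (fun=> c) 0.
Proof. exact: is_derive_cst. Qed.

Lemma der_id x : is_derive x 1 (fun t => t) (1 : R).
Proof. exact: is_derive_id. Qed.

Lemma derZ f x (c l : R) : is_derive x 1 f l ->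
  is_derive x 1 (fun t => c * f t) (c * l).
Proof.
move=> fl; apply: (is_derive_eq (derM (der_cst c x) fl)).
by rewrite mul0r add0r.
Qed.

Lemma der_comp f g x (l m : R) : is_derive (g x) 1 f l -> is_derive x 1 g m ->
  is_derive x 1 (fun t => f (g t)) (l * m).
Proof. by move=> fl gm; exact: is_derive1_comp. Qed.

Lemma der_expR (c x : R) :
  is_derive x 1 (fun t => expR (c * t)) (c * expR (c * x)).
Proof.
have := der_comp (is_derive_expR (c * x)) (derZ c (der_id x)).
by rewrite mulr1 mulrC.
Qed.

Lemma is_derive_itv_continuous f (df : R -> R) a b :
  (forall x, a <= x -> x <= b -> is_derive x 1 f (df x)) ->
  {within `[a, b], continuous f}.
Proof.
move=> H; apply: (@has_derivative_in_continuous _ _ _ df) => x/=.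
rewrite in_itv/= => /andP[ax xb].
exact/is_derive_has_derivative_in/H.
Qed.

Lemma derive_ge0_le f (df : R -> R) a b : a <= b ->
  (forall x, a <= x -> x <= b -> is_derive x 1 f (df x)) ->
  (forall x, a <= x -> x <= b -> 0 <= df x) -> f a <= f b.
Proof.
move=> ab fdf df0.
have fdf' x : x \in `]a, b[ -> is_derive x 1 f (df x).
  by rewrite in_itv/= => /andP[ax xb]; apply: fdf; exact: ltW.
have [c] := MVT_segment ab fdf' (is_derive_itv_continuous fdf).
rewrite in_itv/= => /andP[ac cb] H.
by rewrite -subr_ge0 H mulr_ge0 ?subr_ge0// df0.
Qed.

Lemma derive_le f g (df dg : R -> R) a b : a <= b ->
  (forall x, a <= x -> x <= b -> is_derive x 1 f (df x)) ->
  (forall x, a <= x -> x <= b -> is_derive x 1 g (dg x)) ->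
  (forall x, a <= x -> x <= b -> df x <= dg x) -> f b - f a <= g b - g a.
Proof.
move=> ab fdf gdg dfg.
have : g a - f a <= g b - f b.
  apply: (@derive_ge0_le (fun x => g x - f x) (fun x => dg x - df x)) => //.
    by move=> x ax xb; apply: derB; [exact: gdg|exact: fdf].
  by move=> x ax xb; rewrite subr_ge0 dfg.
by lra.
Qed.

Lemma derive_norm_le f g (df dg : R -> R) a b : a <= b ->
  (forall x, a <= x -> x <= b -> is_derive x 1 f (df x)) ->
  (forall x, a <= x -> x <= b -> is_derive x 1 g (dg x)) ->
  (forall x, a <= x -> x <= b -> `|df x| <= dg x) -> `|f b - f a| <= g b - g a.
Proof.
move=> ab fdf gdg dfg; rewrite ler_norml; apply/andP; split.
  suff : - (g b) - - (g a) <= f b - f a by lra.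
  apply: (@derive_le (fun x => - g x) _ (fun x => - dg x) df) => //.
    by move=> x ax xb; apply: is_deriveN; exact: gdg.
  by move=> x ax xb; have := dfg x ax xb; rewrite ler_norml => /andP[].
apply: (@derive_le _ _ df dg) => // x ax xb.
by have := dfg x ax xb; rewrite ler_norml => /andP[].
Qed.

(** The function f x * expR (- C * x) has derivative at most D. *)
Lemma gronwall f (df : R -> R) (C D : R) b : 0 <= b -> 0 <= C -> 0 <= D ->
  (forall x, 0 <= x -> x <= b -> is_derive x 1 f (df x)) ->
  (forall x, 0 <= x -> x <= b -> df x <= C * f x + D) ->
  f b <= (f 0 + D * b) * expR (C * b).
Proof.
move=> b0 C0 D0 fdf dfC.
have : f b * expR (- C * b) - f 0 * expR (- C * 0) <= D * b - D * 0.
  apply: (@derive_le (fun x => f x * expR (- C * x)) (fun x => D * x)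
    (fun x => df x * expR (- C * x) + f x * (- C * expR (- C * x)))
    (fun=> D * 1)) => //.
  - move=> x x0 xb; apply: derM; [exact: fdf|exact: der_expR].
  - move=> x x0 xb /=.
    have -> : df x * expR (- C * x) + f x * (- C * expR (- C * x)) =
      (df x - C * f x) * expR (- C * x) by ring.
    rewrite mulr1 (@le_trans _ _ (D * expR (- C * x)))//.
      by rewrite ler_wpM2r ?expR_ge0// lerBlDl dfC.
    by rewrite ler_piMr// expR_le1 mulNr oppr_le0 mulr_ge0.
rewrite !mulr0 expR0 mulr1 subr0 lerBlDl mulNr expRN.
by rewrite ler_pdivrMr// expR_gt0.
Qed.

(** A bound from below on f' bounds f a by f b; applied to an energy, it shows
    that a solution which vanishes at b vanishes at a. *)
Lemma gronwall_backward f (df : R -> R) (C : R) a b : a <= b ->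
  (forall x, a <= x -> x <= b -> is_derive x 1 f (df x)) ->
  (forall x, a <= x -> x <= b -> - (C * f x) <= df x) ->
  f a * expR (C * a) <= f b * expR (C * b).
Proof.
move=> ab fdf dfC.
apply: (@derive_ge0_le (fun x => f x * expR (C * x))
   (fun x => df x * expR (C * x) + f x * (C * expR (C * x)))) => //.
- move=> x ax xb; apply: derM; [exact: fdf|exact: der_expR].
- move=> x ax xb /=.
  have -> : df x * expR (C * x) + f x * (C * expR (C * x)) =
      (df x + C * f x) * expR (C * x) by ring.
  by rewrite mulr_ge0 ?expR_ge0// -[X in X + _]opprK addrC subr_ge0 lerNl dfC.
Qed.

(** Precomposition with the projection onto [0, 1] turns a function that is
    continuous on [0, 1] into one that is continuous on the whole line. *)
Definition clamp01 x := Num.max 0 (Num.min x 1).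

Lemma clamp01_itv x : 0 <= clamp01 x <= 1.
Proof.
by rewrite /clamp01 le_max lexx/= ge_max ler01/= ge_min lexx orbT.
Qed.

Lemma clamp01_id x : 0 <= x -> x <= 1 -> clamp01 x = x.
Proof. by move=> x0 x1; rewrite /clamp01 min_l// max_r. Qed.

Lemma clamp01_dist x y : `|clamp01 x - clamp01 y| <= `|x - y|.
Proof.
have := ler_norm (x - y); have := ler_norm (y - x).
rewrite (distrC y x) ler_norml /clamp01 => ? ?; apply/andP.
have m01 : Num.max 0 1 = 1 :> R by rewrite max_r.
by case: (ltP x 1) => ?; case: (ltP y 1) => ?; rewrite ?m01;
  case: (ltP 0 x) => ?; case: (ltP 0 y) => ?; split; lra.
Qed.

Lemma continuous_clamp01 f : {within `[0, 1], continuous f} ->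
  continuous (fun x => f (clamp01 x)).
Proof.
move=> /subspace_continuousP cf x.
have xI : `[0, 1]%classic (clamp01 x) by rewrite /= in_itv/= clamp01_itv.
apply/cvgrPdist_le => e e0.
have /cvgrPdist_le/(_ _ e0) := cf _ xI.
rewrite near_withinE => /nbhs_ballP[r/= r0 H].
apply/nbhs_ballP; exists r => // y xy; apply: H.
  by rewrite /ball/= (le_lt_trans (clamp01_dist _ _)).
by rewrite /= in_itv/= clamp01_itv.
Qed.

(** Integrating from -1 makes this primitive differentiable on both sides of
    each point of [0, 1], the endpoint 0 included. *)
Definition primitive0 f x :=
  \int[mu]_(t in `[- 1, x]) f t - \int[mu]_(t in `[- 1, 0]) f t.

Lemma primitive0_0 f : primitive0 f 0 = 0.
Proof. by rewrite /primitive0 subrr. Qed.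

Lemma is_derive_primitive0 f x : continuous f -> 0 <= x ->
  is_derive x 1 (primitive0 f) (f x).
Proof.
move=> cf x0.
have fi : mu.-integrable `[- 1, x + 1] (EFin \o f).
  apply: continuous_compact_integrable; first exact: segment_compact.
  exact: continuous_subspaceT.
have xx1 : x < x + 1 by rewrite ltrDl.
have N1x : -1 < x by rewrite (lt_le_trans _ x0)// ltrN10.
have [df fx] := continuous_FTC1_closed xx1 fi N1x (cf x).
have dF : is_derive x 1 (fun x => \int[mu]_(t in `[- 1, x]) f t) (f x).
  by rewrite -fx derive1E; exact/derivableP.
by have := derB dF (der_cst (\int[mu]_(t in `[- 1, 0]) f t) x); rewrite subr0.
Qed.

End Calculus.

(** * Linear systems with continuous coefficients *)

Section Picard.
Context {R : realType}.
Implicit Types (x y t : R).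

(** Shifting u n by the tail bound, downwards or upwards, gives an increasing
    and a decreasing sequence; the limit is the supremum of the former. *)
Lemma geometric_limit (u : nat -> R) (B : R) :
  (forall n, `|u n.+1 - u n| <= B / 2 ^+ n) ->
  exists l, forall n, `|l - u n| <= 2 * B / 2 ^+ n.
Proof.
move=> uB.
pose v n := u n + 2 * B / 2 ^+ n; pose w n := u n - 2 * B / 2 ^+ n.
have half n : 2 * B / 2 ^+ n.+1 = B / 2 ^+ n.
  by rewrite exprS; field; rewrite expf_neq0.
have B2 n : 2 * B / 2 ^+ n = B / 2 ^+ n + B / 2 ^+ n by ring.
have vS n : v n.+1 <= v n.
  by have := uB n; rewrite /v half B2 ler_norml => /andP[]; lra.
have wS n : w n <= w n.+1.
  by have := uB n; rewrite /w half B2 ler_norml => /andP[]; lra.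
have vm n m : (n <= m)%N -> v m <= v n by move/nonincreasing_seqP : vS; exact.
have wm n m : (n <= m)%N -> w n <= w m by move/nondecreasing_seqP : wS; exact.
have B0 : 0 <= B by have := uB 0%N; rewrite expr0 divr1; exact: le_trans.
have wv n m : w n <= v m.
  apply: (@le_trans _ _ (w (maxn n m))); first by apply: wm; exact: leq_maxl.
  apply: (@le_trans _ _ (v (maxn n m))); last by apply: vm; exact: leq_maxr.
  rewrite /w /v; have : 0 <= 2 * B / 2 ^+ maxn n m.
    by rewrite divr_ge0 ?mulr_ge0 ?exprn_ge0.
  by lra.
exists (sup (range w)) => n.
have : w n <= sup (range w).
  by apply: ub_le_sup; [exists (v 0%N) => _ [m _ <-]|exists n].
have : sup (range w) <= v n.
  by apply: ge_sup; [exists (w 0%N); exists 0%N|move=> _ [m _ <-]].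
by rewrite /v /w ler_norml => ? ?; apply/andP; split; lra.
Qed.

Lemma geometric_lt (B e : R) : 0 < e -> exists n, B / 2 ^+ n < e.
Proof.
move=> e0; exists (Num.bound (B / e)).
rewrite ltr_pdivrMr ?exprn_gt0// mulrC -ltr_pdivrMr//.
exact: upper_nthrootP.
Qed.

Lemma uniform_limit_geometric (f : nat -> R -> R) (B : R) :
  (forall n x, 0 <= x -> x <= 1 -> `|f n.+1 x - f n x| <= B / 2 ^+ n) ->
  (forall n, {within `[0, 1], continuous (f n)}) ->
  exists2 g : R -> R, {within `[0, 1], continuous g} &
    forall n x, 0 <= x -> x <= 1 -> `|g x - f n x| <= 2 * B / 2 ^+ n.
Proof.
move=> fB fc.
have /choice[g Hg] : forall x, exists l, 0 <= x -> x <= 1 ->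
    forall n, `|l - f n x| <= 2 * B / 2 ^+ n.
  move=> x; have [/andP[x0 x1]|x01] := boolP (0 <= x <= 1).
    have [l Hl] := @geometric_limit (f^~ x) B (fun n => fB n x x0 x1).
    by exists l.
  by exists 0 => x0 x1; move: x01; rewrite x0 x1.
exists g; last by move=> n x x0 x1; exact: Hg.
apply/subspace_continuousP => x /=; rewrite in_itv/= => /andP[x0 x1].
apply/cvgrPdist_le => e e0; have e30 : 0 < e / 3 by rewrite divr_gt0.
have [n nB] := geometric_lt (2 * B) e30.
have /subspace_continuousP/(_ x) := fc n; rewrite /= in_itv/= x0 x1 => /(_ isT).
move=> /cvgrPdist_le/(_ _ e30); rewrite !near_withinE.
apply: filterS => y H yI; have := yI; rewrite /= in_itv/= => /andP[y0 y1].
have := H yI; have := Hg x x0 x1 n; have := Hg y y0 y1 n.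
move: nB; set b := (2 * B / 2 ^+ n) => nB.
rewrite /from_subspace !ler_norml => /andP[? ?] /andP[? ?] /andP[? ?].
by apply/andP; split; lra.
Qed.

(** Picard iteration. In the weight expR (2 * C * x) the iteration contracts by
    a factor 1/2, since differentiating the weight produces the factor 2 * C;
    so successive iterates differ by O(2 ^- n) on the whole of [0, 1]. *)
Lemma linear_system (I : finType) (M : I -> I -> R -> R) (x0 : I -> R) (C : R) :
  0 <= C -> (forall i j, continuous (M i j)) ->
  (forall i (x : R), 0 <= x -> x <= 1 -> \sum_j `|M i j x| <= C) ->
  exists X : I -> R -> R, (forall i, X i 0 = x0 i) /\
    forall i (x : R), 0 <= x -> x <= 1 -> is_derive x 1 (X i) (\sum_j M i j x * X j x).
Proof.
move=> C0 Mc MC.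
pose rhs (X : I -> R -> R) i t := \sum_j M i j t * X j (clamp01 t).
(* T is the Picard map; [rhs] reads its argument on [0, 1] only. *)
pose T (X : I -> R -> R) i x := x0 i + primitive0 (rhs X i) x.
(* Starting from 0 makes the first increment the constant x0. *)
pose X n := iter n T (fun _ _ => 0).
pose cts (X : I -> R -> R) := forall i, {within `[0, 1], continuous (X i)}.
have rhs_cts Y i : cts Y -> continuous (rhs Y i).
  move=> Yc; rewrite /rhs; elim: (index_enum I) => [|j s IHs] x.
    by under eq_fun do rewrite big_nil; exact: cst_continuous.
  under eq_fun do rewrite big_cons.
  apply: cvgD; last exact: IHs.
  by apply: cvgM; [exact: Mc|exact: continuous_clamp01].
have dT Y i x : cts Y -> 0 <= x -> x <= 1 ->
    is_derive x 1 (T Y i) (\sum_j M i j x * Y j x).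
  move=> Yc x_ge0 x1.
  have -> : \sum_j M i j x * Y j x = rhs Y i x.
    by apply: eq_bigr => j _; rewrite clamp01_id.
  have := derD (der_cst (x0 i) x) (is_derive_primitive0 (rhs_cts Y i Yc) x_ge0).
  by rewrite add0r.
have T_cts Y : cts Y -> cts (T Y).
  by move=> Yc i; apply: is_derive_itv_continuous => x; exact: dT.
have T0 Y i : T Y i 0 = x0 i by rewrite /T primitive0_0 addr0.
have XS0 n i : X n.+1 i 0 = x0 i by exact: T0.
have X_cts n : cts (X n).
  elim: n => [|n]; last exact: T_cts.
  by move=> i; apply: continuous_subspaceT; exact: cst_continuous.
have T_lip Y Z i x (e : R) : 0 <= x -> x <= 1 ->
    (forall j, `|Y j x - Z j x| <= e) ->
    `|\sum_j M i j x * Y j x - \sum_j M i j x * Z j x| <= C * e.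
  move=> x_ge0 x1 YZ.
  rewrite -sumrB (le_trans (ler_norm_sum _ _ _))//.
  apply: (@le_trans _ _ ((\sum_j `|M i j x|) * e)).
    by rewrite mulr_suml; apply: ler_sum => j _; rewrite -mulrBr normrM ler_wpM2l.
  rewrite ler_wpM2r ?MC//.
  by apply: le_trans (YZ i).
pose K := \sum_i `|x0 i|.
have K0 : 0 <= K by apply: sumr_ge0.
have X_incr n i x : 0 <= x -> x <= 1 ->
    `|X n.+1 i x - X n i x| <= K / 2 ^+ n * expR (2 * C * x).
  elim: n i x => [|n IH] i x x_ge0 x1.
    have -> : X 1%N i x = x0 i.
      rewrite /X/= /T (_ : rhs _ i = fun=> 0); last first.
        by apply/funext => t; rewrite /rhs big1// => j _; rewrite mulr0.
      by rewrite /primitive0 !Rintegral_cst// !mul0r subrr addr0.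
    rewrite subr0 expr0 divr1; apply: (@le_trans _ _ K).
      by rewrite /K (bigD1 i)//= lerDl sumr_ge0.
    by rewrite ler_peMr// -expR0 ler_expR !mulr_ge0.
  have -> : X n.+2 i x - X n.+1 i x =
      (X n.+2 i x - X n.+1 i x) - (X n.+2 i 0 - X n.+1 i 0).
    by rewrite !XS0 subrr subr0.
  apply: (@le_trans _ _ (K / 2 ^+ n.+1 * expR (2 * C * x)
                         - K / 2 ^+ n.+1 * expR (2 * C * 0))).
    apply: (@derive_norm_le _ (fun x => X n.+2 i x - X n.+1 i x)
      (fun x => K / 2 ^+ n.+1 * expR (2 * C * x))
      (fun x => \sum_j M i j x * X n.+1 j x - \sum_j M i j x * X n j x)
      (fun x => K / 2 ^+ n.+1 * (2 * C * expR (2 * C * x))) 0 x x_ge0).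
    - move=> t t0 tx; have t1 := le_trans tx x1.
      exact: (derB (dT _ i t (X_cts n.+1) t0 t1) (dT _ i t (X_cts n) t0 t1)).
    - by move=> t t0 tx; exact: (derZ _ (der_expR _ t)).
    - move=> t t0 tx; have t1 := le_trans tx x1.
      have -> : K / 2 ^+ n.+1 * (2 * C * expR (2 * C * t)) =
                C * (K / 2 ^+ n * expR (2 * C * t)).
        by rewrite exprS; field; rewrite expf_neq0.
      by apply: T_lip => // j; exact: IH.
  by rewrite lerBlDr lerDl mulr_ge0 ?expR_ge0// divr_ge0// exprn_ge0.
have /choice[g Hg] : forall i, exists g : R -> R, {within `[0, 1], continuous g} /\
    forall n x, 0 <= x -> x <= 1 ->
      `|g x - X n i x| <= 2 * (K * expR (2 * C)) / 2 ^+ n.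
  move=> i; have [] := @uniform_limit_geometric (fun n => X n i) (K * expR (2 * C)).
  - move=> n x x_ge0 x1; apply: (le_trans (X_incr n i x x_ge0 x1)).
    rewrite [leRHS]mulrAC ler_wpM2l ?divr_ge0 ?exprn_ge0//.
    by rewrite ler_expR ler_piMr// mulr_ge0.
  - by move=> n; exact: X_cts.
  - by move=> g gc gX; exists g.
have gc : cts g by move=> i; have [] := Hg i.
pose B := 2 * (K * expR (2 * C)).
have gX n i x : 0 <= x -> x <= 1 -> `|g i x - X n i x| <= B / 2 ^+ n.
  by have [_] := Hg i; exact.
have TgE i x : 0 <= x -> x <= 1 -> T g i x = g i x.
  move=> x_ge0 x1; apply/eqP; rewrite -subr_eq0 -normr_le0.
  apply/ler_addgt0Pr => e e0; rewrite add0r.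
  have [n nB] := geometric_lt ((C + 1) * B) e0.
  apply: le_trans (ltW nB).
  have TgX : `|T g i x - X n.+1 i x| <= C * (B / 2 ^+ n).
    have -> : T g i x - X n.+1 i x =
        (T g i x - X n.+1 i x) - (T g i 0 - X n.+1 i 0) by rewrite T0 XS0 subrr subr0.
    apply: (@le_trans _ _ (C * (B / 2 ^+ n) * x - C * (B / 2 ^+ n) * 0)).
      apply: (@derive_norm_le _ (fun x => T g i x - X n.+1 i x)
        (fun x => C * (B / 2 ^+ n) * x)
        (fun x => \sum_j M i j x * g j x - \sum_j M i j x * X n j x)
        (fun x => C * (B / 2 ^+ n) * 1) 0 x x_ge0).
      - move=> t t0 tx; have t1 := le_trans tx x1.
        exact: (derB (dT _ i t gc t0 t1) (dT _ i t (X_cts n) t0 t1)).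
      - move=> t t0 tx; have t1 := le_trans tx x1; rewrite mulr1.
        by apply: T_lip => // j; exact: gX.
    rewrite mulr0 subr0 ler_piMr// mulr_ge0//.
    by rewrite divr_ge0 ?exprn_ge0// !mulr_ge0// expR_ge0.
  have := gX n.+1 i x x_ge0 x1.
  have B2 : B / 2 ^+ n.+1 <= B / 2 ^+ n.
    rewrite ler_wpM2l ?mulr_ge0 ?expR_ge0// lef_pV2 ?posrE ?exprn_gt0//.
    by rewrite exprS ler_peMl ?exprn_ge0// ler1n.
  have -> : (C + 1) * B / 2 ^+ n = C * (B / 2 ^+ n) + B / 2 ^+ n by ring.
  move: TgX; rewrite !ler_norml => /andP[? ?] /andP[? ?].
  by apply/andP; split; lra.
exists (T g); split => // i x x_ge0 x1.
have -> : \sum_j M i j x * T g j x = \sum_j M i j x * g j x.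
  by apply: eq_bigr => j _; rewrite TgE.
exact: dT.
Qed.

End Picard.

(** * The quasi-derivative system *)

Section QuasiDerivative.
Context {R : realType}.
Implicit Types (Q Y W : R -> R) (x l m N : R).

(** When Q' = q and Q 0 = 0, this says that Y solves - Y'' + q Y = l Y with
    Y 0 = 1 and Y' 0 = 0, and that W is its quasi-derivative Y' - Q Y. The
    system still makes sense when Q is merely continuous. *)
Definition quasi_solution Q l Y W := [/\ Y 0 = 1, W 0 = 0,
  forall x, 0 <= x -> x <= 1 -> is_derive x 1 Y (W x + Q x * Y x) &
  forall x, 0 <= x -> x <= 1 ->
    is_derive x 1 W (- (l + Q x ^+ 2) * Y x - Q x * W x)].

Lemma quasi_solution_exists Q l : continuous Q ->
  exists Y W, quasi_solution Q l Y W.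
Proof.
move=> Qc.
have [N N0 QN] := continuous_bounded ler01 (continuous_subspaceT Qc).
pose M (i j : bool) x : R :=
  if i then (if j then Q x else 1) else (if j then - (l + Q x ^+ 2) else - Q x).
pose C := 1 + `|l| + N ^+ 2 + N.
have C0 : 0 <= C by rewrite !addr_ge0// exprn_ge0.
have [i j||X [X0 dX]] := @linear_system _ _ M (fun i => if i then 1 else 0) C C0.
- case: i; case: j => x; rewrite /M; [exact: Qc|exact: cst_continuous| |].
    by apply: cvgN; apply: cvgD; [exact: cvg_cst|exact: cvgM (Qc x) (Qc x)].
  exact: cvgN (Qc x).
- move=> i x x0 x1; rewrite big_bool /M /C.
  have Qx := QN _ x0 x1.
  have Q2 : Q x ^+ 2 <= N ^+ 2.
    by rewrite -[Q x ^+ 2]ger0_norm ?sqr_ge0// normrX lerXn2r ?nnegrE.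
  have := sqr_ge0 N; have := normr_ge0 l.
  case: i => /= ? ?; first by rewrite normr1; lra.
  rewrite !normrN; have := ler_normD l (Q x ^+ 2).
  by rewrite [`|_ ^+ 2|]ger0_norm ?sqr_ge0//; lra.
exists (X true), (X false); split; [exact: X0|exact: X0| |] => x x0 x1.
  by apply: (is_derive_eq (dX true x x0 x1)); rewrite big_bool /M/=; ring.
by apply: (is_derive_eq (dX false x x0 x1)); rewrite big_bool /M/=; ring.
Qed.

(** The derivative of the energy Y ^ 2 + W ^ 2 along the system is at most a
    constant times the energy, in absolute value; this gives uniqueness,
    bounds and dependence on l. *)
Lemma energy_le (y w p l N : R) : `|p| <= N ->
  `|2 * y * (w + p * y) + 2 * w * (- (l + p ^+ 2) * y - p * w)| <=
  (1 + `|l| + N ^+ 2 + 2 * N) * (y ^+ 2 + w ^+ 2).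
Proof.
move=> pN.
have -> : 2 * y * (w + p * y) + 2 * w * (- (l + p ^+ 2) * y - p * w) =
  (1 - l - p ^+ 2) * (2 * y * w) + 2 * p * (y ^+ 2 - w ^+ 2) by ring.
have p2 : p ^+ 2 <= N ^+ 2.
  by rewrite -[p ^+ 2]ger0_norm ?sqr_ge0// normrX lerXn2r ?nnegrE// (le_trans _ pN).
have yw : `|2 * y * w| <= y ^+ 2 + w ^+ 2.
  have := sqr_ge0 (y + w); have := sqr_ge0 (y - w); rewrite ler_norml => ? ?.
  by apply/andP; split; lra.
have yw' : `|y ^+ 2 - w ^+ 2| <= y ^+ 2 + w ^+ 2.
  have := sqr_ge0 y; have := sqr_ge0 w; rewrite ler_norml => ? ?.
  by apply/andP; split; lra.
have c1 : `|1 - l - p ^+ 2| <= 1 + `|l| + N ^+ 2.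
  have := ler_normB (1 - l) (p ^+ 2); have := ler_normB 1 l.
  by rewrite normr1 [`|_ ^+ 2|]ger0_norm ?sqr_ge0//; lra.
rewrite (le_trans (ler_normD _ _))// [leRHS]mulrDl; apply: lerD.
  by rewrite normrM; exact: ler_pM.
rewrite normrM; apply: ler_pM => //.
by rewrite normrM ger0_norm// ler_wpM2l.
Qed.

Section Solution.
Variables (Q Y W : R -> R) (l N : R).
Hypothesis QN : forall x, 0 <= x -> x <= 1 -> `|Q x| <= N.
Hypothesis QYW : quasi_solution Q l Y W.

Let dY x : 0 <= x -> x <= 1 -> is_derive x 1 Y (W x + Q x * Y x).
Proof. by case: QYW => _ _ + _; exact. Qed.

Let dW x : 0 <= x -> x <= 1 ->
  is_derive x 1 W (- (l + Q x ^+ 2) * Y x - Q x * W x).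
Proof. by case: QYW => _ _ _; exact. Qed.

Let dsq (f : R -> R) x (a : R) : is_derive x 1 f a ->
  is_derive x 1 (fun t => f t ^+ 2) (2 * f x * a).
Proof.
move=> fa; apply: (is_derive_eq (derM fa fa)).
by rewrite [a * _]mulrC -mulr2n mulr_natl mulrnAl.
Qed.

Let N0 : 0 <= N.
Proof. by apply: le_trans (normr_ge0 (Q 0)) (QN _ _). Qed.

Let C := 1 + `|l| + N ^+ 2 + 2 * N.

Let C0 : 0 <= C.
Proof. by rewrite !addr_ge0 ?exprn_ge0 ?mulr_ge0. Qed.

Let dE x : 0 <= x -> x <= 1 -> is_derive x 1 (fun t => Y t ^+ 2 + W t ^+ 2)
  (2 * Y x * (W x + Q x * Y x) +
   2 * W x * (- (l + Q x ^+ 2) * Y x - Q x * W x)).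
Proof. by move=> x0 x1; apply: derD; apply: dsq; [exact: dY|exact: dW]. Qed.

(** A double zero would force, backwards, the energy at 0 to vanish. *)
Lemma quasi_solution_neq0 x : 0 <= x -> x <= 1 -> Y x = 0 -> W x <> 0.
Proof.
move=> x0 x1 Yx Wx.
have : (Y 0 ^+ 2 + W 0 ^+ 2) * expR (C * 0) <=
       (Y x ^+ 2 + W x ^+ 2) * expR (C * x).
  apply: (@gronwall_backward _ (fun t => Y t ^+ 2 + W t ^+ 2) _ C 0 x x0) => t t0 tx.
    by apply: dE => //; exact: le_trans x1.
  have := energy_le (Y t) (W t) l (QN t0 (le_trans tx x1)).
  by rewrite ler_norml => /andP[].
case: QYW => -> -> _ _.
by rewrite Yx Wx mulr0 expR0 expr0n/= !addr0 mul0r mulr1 expr1n ler10.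
Qed.

Lemma quasi_solution_le x : 0 <= x -> x <= 1 ->
  Y x ^+ 2 + W x ^+ 2 <= expR (1 + `|l| + N ^+ 2 + 2 * N).
Proof.
move=> x0 x1; rewrite -/C.
have : Y x ^+ 2 + W x ^+ 2 <=
    (Y 0 ^+ 2 + W 0 ^+ 2 + 0 * x) * expR (C * x).
  apply: (@gronwall _ (fun t => Y t ^+ 2 + W t ^+ 2) _ C 0 x x0) => // t t0 tx.
    by apply: dE => //; exact: le_trans x1.
  rewrite addr0.
  have := energy_le (Y t) (W t) l (QN t0 (le_trans tx x1)).
  by rewrite ler_norml => /andP[].
case: QYW => -> -> _ _; rewrite mul0r expr1n expr0n/= !addr0 mul1r.
by move/le_trans; apply; rewrite ler_expR ler_piMr.
Qed.

(** Replacing Q by Q + c changes the quasi-derivative into W - c Y and keeps the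
    equation, and
      (Y (W - c Y))' = (W - c Y) ^ 2 + (- l - (Q + c) ^ 2) Y ^ 2.
    When - l is large the right-hand side is bounded from below by b * a. *)
Lemma quasi_product_ge (c a b : R) x : 0 <= x -> x <= 1 -> 0 <= a ->
  (forall t, 0 <= t -> t <= x -> a <= Y t ^+ 2) ->
  (forall t, 0 <= t -> t <= x -> b <= - l - (Q t + c) ^+ 2) -> 0 <= b ->
  b * a * x - c <= Y x * (W x - c * Y x).
Proof.
move=> x0 x1 a0 aY bl b0.
have : b * a * x - b * a * 0 <= Y x * (W x - c * Y x) - Y 0 * (W 0 - c * Y 0).
  apply: (@derive_le _ (fun t => b * a * t) (fun t => Y t * (W t - c * Y t))
    (fun t => b * a * 1)
    (fun t => (W t - c * Y t) ^+ 2 + (- l - (Q t + c) ^+ 2) * Y t ^+ 2)) => //.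
  - move=> t t0 tx; have t1 := le_trans tx x1.
    apply: (is_derive_eq (derM (dY t0 t1) (derB (dW t0 t1) (derZ c (dY t0 t1))))).
    by ring.
  - move=> t t0 tx; rewrite mulr1 -[leLHS]add0r lerD ?sqr_ge0//.
    by apply: ler_pM; [| |exact: bl|exact: aY].
case: QYW => -> -> _ _; rewrite mulr0 subr0 mul1r mulr1 sub0r opprK.
by rewrite lerBlDr.
Qed.

(** With c = 0, [quasi_product_ge] gives Y W >= 0, hence
    (Y ^ 2)' = 2 Y W + 2 Q Y ^ 2 >= - 2 N Y ^ 2. *)
Lemma quasi_solution_sq_ge x : N ^+ 2 <= - l -> 0 <= x -> x <= 1 ->
  expR (- (2 * N)) <= Y x ^+ 2.
Proof.
move=> Nl x0 x1.
have YW t : 0 <= t -> t <= 1 -> 0 <= Y t * W t.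
  move=> t0 t1.
  have := @quasi_product_ge 0 0 0 t t0 t1 (lexx _).
  rewrite !mul0r subrr subr0; apply => //; first by move=> *; exact: sqr_ge0.
  move=> s s0 st; rewrite addr0 subr_ge0 (le_trans _ Nl)//.
  rewrite -[Q s ^+ 2]ger0_norm ?sqr_ge0// normrX lerXn2r ?nnegrE//.
  by rewrite QN// (le_trans st).
have : Y 0 ^+ 2 * expR (2 * N * 0) <= Y x ^+ 2 * expR (2 * N * x).
  apply: (@gronwall_backward _ (fun t => Y t ^+ 2) _ _ 0 x x0) => t t0 tx.
    by apply: dsq; apply: dY => //; exact: le_trans x1.
  have t1 := le_trans tx x1.
  have -> : 2 * Y t * (W t + Q t * Y t) = 2 * (Y t * W t) + 2 * Q t * Y t ^+ 2.
    by ring.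
  have : - N * Y t ^+ 2 <= Q t * Y t ^+ 2.
    rewrite ler_wpM2r ?sqr_ge0//.
    by have := QN t0 t1; rewrite ler_norml => /andP[].
  by have := YW t t0 t1; lra.
case: QYW => -> _ _ _; rewrite mulr0 expR0 expr1n mulr1 => H.
rewrite expRN -[leLHS]mul1r ler_pdivrMr ?expR_gt0//.
apply: (le_trans H); rewrite ler_wpM2l ?sqr_ge0// ler_expR.
by rewrite ler_piMr// mulr_ge0.
Qed.

Lemma quasi_solution_continuous : {within `[0, 1], continuous Y}.
Proof. exact: is_derive_itv_continuous dY. Qed.

Lemma quasi_solution_gt0 : (forall x, 0 <= x -> x <= 1 -> Y x <> 0) ->
  forall x, 0 <= x -> x <= 1 -> 0 < Y x.
Proof.
move=> Y0 x x0 x1; rewrite ltNge; apply/negP => Yx.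
have Yc : {within `[0, x], continuous Y}.
  by apply: continuous_subspaceW quasi_solution_continuous; exact: subset_itvl.
have [|c] := @IVT _ Y 0 x 0 x0 Yc.
  by case: QYW => -> _ _ _; rewrite ge_min Yx orbT/= le_max ler01.
by rewrite in_itv/= => /andP[c0 cx]; apply: Y0 => //; exact: le_trans x1.
Qed.

(** With c = N, [quasi_product_ge] makes Y (W - N Y) positive at 1, and
    Y' 1 = W 1 + Q 1 * Y 1 is at least W 1 - N * Y 1. *)
Lemma quasi_solution_very_negative :
  4 * N ^+ 2 + (N + 1) * expR (2 * N) <= - l ->
  (forall x, 0 <= x -> x <= 1 -> 0 < Y x) /\ 0 < W 1 + Q 1 * Y 1.
Proof.
move=> Nl; have e0 := expR_gt0 (2 * N).
have N20 : 0 <= N ^+ 2 by rewrite exprn_ge0.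
have H0 : 0 <= (N + 1) * expR (2 * N).
  by rewrite mulr_ge0 ?addr_ge0// ltW.
have Ypos x : 0 <= x -> x <= 1 -> 0 < Y x.
  apply: quasi_solution_gt0 => t t0 t1 Yt.
  have : expR (- (2 * N)) <= Y t ^+ 2 by apply: quasi_solution_sq_ge => //; lra.
  by rewrite Yt expr0n/= leNgt expR_gt0.
split => //.
have := @quasi_product_ge N (expR (- (2 * N))) ((N + 1) * expR (2 * N)) 1
  ler01 (lexx _) (expR_ge0 _).
rewrite mulr1 expRN -mulrA divff ?gt_eqF// mulr1 => H.
have {H} : N + 1 - N <= Y 1 * (W 1 - N * Y 1).
  apply: H => //.
    by move=> t t0 t1; rewrite -expRN; apply: quasi_solution_sq_ge => //; lra.
  move=> t t0 t1; have := QN t0 t1; rewrite ler_norml => /andP[Q1 Q2].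
  have : (Q t + N) ^+ 2 <= (2 * N) ^+ 2 by rewrite lerXn2r ?nnegrE; lra.
  by rewrite exprMn; lra.
have Y1 := Ypos 1 ler01 (lexx _).
have := QN ler01 (lexx _); rewrite ler_norml => /andP[Q1 Q2] D1.
have D : 0 < W 1 - N * Y 1 by rewrite -(pmulr_rgt0 _ Y1); lra.
have : - N * Y 1 <= Q 1 * Y 1 by rewrite ler_wpM2r// ltW.
by lra.
Qed.

Section Riccati.
Hypothesis Ypos : forall x, 0 <= x -> x <= 1 -> 0 < Y x.

(** The Riccati equation of v = W / Y. Here Q + v = Y' / Y, so the right-hand
    side is - l - (Y' / Y) ^ 2. *)
Lemma is_derive_riccati x : 0 <= x -> x <= 1 ->
  is_derive x 1 (fun t => W t / Y t) (- l - (Q x + W x / Y x) ^+ 2).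
Proof.
move=> x0 x1; have Yx : Y x != 0 by rewrite gt_eqF// Ypos.
have dV : is_derive x 1 (fun t => (Y t)^-1) (- (Y x) ^- 2 * (W x + Q x * Y x)).
  by apply: (is_derive_eq (is_deriveV Yx (dY x0 x1))).
apply: (is_derive_eq (derM (dW x0 x1) dV)).
by field.
Qed.

Lemma riccati_le s x : 0 <= s -> s <= x -> x <= 1 ->
  W x / Y x - W s / Y s <= - l * (x - s).
Proof.
move=> s0 sx x1.
rewrite mulrBr.
apply: (@derive_le _ (fun t => W t / Y t) (fun t => - l * t)
  (fun t => - l - (Q t + W t / Y t) ^+ 2) (fun t => - l * 1)) => //.
- move=> t st tx; apply: is_derive_riccati; first exact: le_trans st.
  exact: le_trans x1.
- by move=> t st tx; rewrite mulr1 gerBl sqr_ge0.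
Qed.

(** Case of equality: v + l x does not increase and takes the value 0 at both
    ends, hence is 0; then v' = - l, so that Q + v = 0. *)
Lemma riccati_eq : l = Q 1 -> W 1 + Q 1 * Y 1 = 0 ->
  forall x, 0 < x -> x < 1 -> Q x = Q 1 * x.
Proof.
move=> lQ Z1.
have Y1 : Y 1 != 0 by rewrite gt_eqF// Ypos.
have v1 : W 1 / Y 1 = - l.
  have -> : W 1 = - Q 1 * Y 1 by lra.
  by rewrite mulfK// lQ.
have v0 : W 0 / Y 0 = 0 by case: QYW => _ -> _ _; rewrite mul0r.
have v x : 0 <= x -> x <= 1 -> W x / Y x = - l * x.
  move=> x0 x1; apply/eqP; rewrite eq_le.
  have := riccati_le (lexx _) x0 x1; have := riccati_le x0 x1 (lexx _).
  by rewrite v0 v1 => ? ?; apply/andP; split; lra.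
move=> x x0 x1.
have d1 : is_derive x 1 (fun t => W t / Y t) (- l * 1).
  apply: (@is_derive_eq_near _ (fun t => - l * t) _ _ _ (Num.min x (1 - x))).
  - by rewrite lt_min x0 subr_gt0.
  - move=> z; rewrite lt_min => /andP[/ltr_normlP[z1 z2] /ltr_normlP[z3 z4]].
    by rewrite v//; lra.
have d2 := is_derive_riccati (ltW x0) (ltW x1).
have : - l - (Q x + W x / Y x) ^+ 2 = - l * 1.
  by rewrite -(@derive_val _ _ _ _ _ _ _ d1) -(@derive_val _ _ _ _ _ _ _ d2).
rewrite mulr1 => /eqP; rewrite subr_eq addrC -subr_eq subrr eq_sym sqrf_eq0.
by rewrite v ?ltW// addr_eq0 => /eqP ->; rewrite mulNr opprK lQ.
Qed.

End Riccati.

End Solution.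
End QuasiDerivative.

(** * Existence of a positive eigenfunction *)

Section PositiveEigenfunction.
Context {R : realType}.
Implicit Types (Q Y W f : R -> R) (x l m N d : R).

Lemma derive_left_min a x f d : a < x -> is_derive x 1 f d ->
  (forall z, a <= z -> z <= x -> f x <= f z) -> d <= 0.
Proof.
move=> ax fd fmin; rewrite leNgt; apply/negP => d0.
have d20 : 0 < d / 2 by rewrite divr_gt0.
have [r r0 H] := (is_derive_approxP _ _ _).1 fd _ d20.
pose h := Num.min (r / 2) (x - a).
have h0 : 0 < h by rewrite lt_min subr_gt0 ax divr_gt0.
have hr : h <= r / 2 by rewrite /h ge_min lexx.
have ha : h <= x - a by rewrite /h ge_min lexx orbT.
have := H (x - h); rewrite (_ : x - h - x = - h); last by ring.
rewrite normrN gtr0_norm// ler_norml => H'.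
have /H'/andP[_] : h < r by lra.
have dh : 0 < d * h by rewrite mulr_gt0.
have := fmin (x - h); rewrite mulrN opprK => fx.
have : f x <= f (x - h) by apply: fx; lra.
by lra.
Qed.

Lemma derive_right_min b x f d : x < b -> is_derive x 1 f d ->
  (forall z, x <= z -> z <= b -> f x <= f z) -> 0 <= d.
Proof.
move=> xb fd fmin; rewrite leNgt; apply/negP => d0.
have d20 : 0 < - d / 2 by rewrite divr_gt0// oppr_gt0.
have [r r0 H] := (is_derive_approxP _ _ _).1 fd _ d20.
pose h := Num.min (r / 2) (b - x).
have h0 : 0 < h by rewrite lt_min subr_gt0 xb divr_gt0.
have hr : h <= r / 2 by rewrite /h ge_min lexx.
have ha : h <= b - x by rewrite /h ge_min lexx orbT.
have := H (x + h); rewrite (_ : x + h - x = h); last by ring.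
rewrite gtr0_norm// ler_norml => H'.
have /H'/andP[_] : h < r by lra.
have dh : 0 < - d * h by rewrite mulr_gt0// oppr_gt0.
have : f x <= f (x + h) by apply: fmin; lra.
by lra.
Qed.

(** The difference of two solutions satisfies the same system with the source
    term (m - l) * Y2, to which the energy estimate applies. *)
Lemma quasi_solution_lipschitz Q N L : (forall x, 0 <= x -> x <= 1 -> `|Q x| <= N) ->
  exists2 K : R, 0 <= K & forall l m Y1 W1 Y2 W2,
    `|l| <= L -> `|m| <= L ->
    quasi_solution Q l Y1 W1 -> quasi_solution Q m Y2 W2 ->
    forall x, 0 <= x -> x <= 1 ->
    `|Y1 x - Y2 x| <= K * `|l - m| /\ `|W1 x - W2 x| <= K * `|l - m|.
Proof.
move=> QN.
have N0 : 0 <= N by apply: le_trans (normr_ge0 (Q 0)) (QN _ _ _).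
pose C := 1 + L + N ^+ 2 + 2 * N.
exists (expR (2 * C + 1)); first exact: expR_ge0.
move=> l m Y1 W1 Y2 W2 lL mL S1 S2 x x0 x1.
have L0 : 0 <= L by exact: le_trans lL.
have C0 : 0 <= C by rewrite !addr_ge0 ?exprn_ge0 ?mulr_ge0.
pose E t := (Y1 t - Y2 t) ^+ 2 + (W1 t - W2 t) ^+ 2.
(* The energy grows at the rate C, and the source term adds one more unit. *)
have E_le : E x <= (expR (2 * C + 1) * `|l - m|) ^+ 2.
  have := @gronwall _ E (fun t =>
     (2 * (Y1 t - Y2 t) * ((W1 t - W2 t) + Q t * (Y1 t - Y2 t)) +
      2 * (W1 t - W2 t) * (- (l + Q t ^+ 2) * (Y1 t - Y2 t) - Q t * (W1 t - W2 t)))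
     - 2 * (W1 t - W2 t) * ((l - m) * Y2 t))
     (C + 1) ((l - m) ^+ 2 * expR C) x x0.
  have D0 : 0 <= (l - m) ^+ 2 * expR C by rewrite mulr_ge0 ?sqr_ge0 ?expR_ge0.
  rewrite addr_ge0// => /(_ isT D0) H.
  apply: (le_trans (H _ _)).
  - move=> t t0 tx; have t1 := le_trans tx x1.
    case: S1 => _ _ dY1 dW1; case: S2 => _ _ dY2 dW2.
    have dy := derB (dY1 t t0 t1) (dY2 t t0 t1).
    have dw := derB (dW1 t t0 t1) (dW2 t t0 t1).
    by apply: (is_derive_eq (derD (derM dy dy) (derM dw dw))); ring.
  - move=> t t0 tx; have t1 := le_trans tx x1.
    have := energy_le (Y1 t - Y2 t) (W1 t - W2 t) l (QN t t0 t1).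
    rewrite ler_norml => /andP[_ e1].
    have e2 : (1 + `|l| + N ^+ 2 + 2 * N) * E t <= C * E t.
      by rewrite ler_wpM2r ?addr_ge0 ?sqr_ge0// /C; lra.
    have e3 : - 2 * (W1 t - W2 t) * ((l - m) * Y2 t) <=
              (W1 t - W2 t) ^+ 2 + (l - m) ^+ 2 * Y2 t ^+ 2.
      by rewrite -exprMn; have := sqr_ge0 ((W1 t - W2 t) + (l - m) * Y2 t); lra.
    have e4 : (l - m) ^+ 2 * Y2 t ^+ 2 <= (l - m) ^+ 2 * expR C.
      rewrite ler_wpM2l ?sqr_ge0//.
      have := quasi_solution_le QN S2 t0 t1.
      have : expR (1 + `|m| + N ^+ 2 + 2 * N) <= expR C by rewrite ler_expR /C; lra.
      by have := sqr_ge0 (W2 t); lra.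
    have e5 : (W1 t - W2 t) ^+ 2 <= E t by rewrite lerDr sqr_ge0.
    have e6 := le_trans e1 e2.
    by lra.
  - case: S1 S2 => Y10 W10 _ _ [Y20 W20 _ _].
    have -> : (expR (2 * C + 1) * `|l - m|) ^+ 2 =
        (l - m) ^+ 2 * (expR (2 * C + 1) * expR (2 * C + 1)).
      by rewrite exprMn -normrX ger0_norm ?sqr_ge0//; ring.
    rewrite /E Y10 W10 Y20 W20 !subrr expr0n/= addr0 add0r.
    have -> : forall s u v w : R, s * u * v * w = s * (u * (v * w)) by move=> *; ring.
    have Cx : (C + 1) * x <= C + 1 by rewrite ler_piMr// addr_ge0.
    rewrite ler_wpM2l ?sqr_ge0// ler_pM ?mulr_ge0 ?expR_ge0//.
      by rewrite ler_expR; lra.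
    by rewrite -[leRHS]mul1r ler_pM ?expR_ge0// ler_expR; lra.
have K0 : 0 <= expR (2 * C + 1) * `|l - m| by rewrite mulr_ge0 ?expR_ge0.
split; rewrite -ler_sqr ?nnegrE// -normrX ger0_norm ?sqr_ge0//.
  by apply: le_trans E_le; rewrite lerDl sqr_ge0.
by apply: le_trans E_le; rewrite lerDr sqr_ge0.
Qed.

Lemma ler_norm_minB (a b c d e : R) : `|a - c| <= e -> `|b - d| <= e ->
  `|Num.min a b - Num.min c d| <= e.
Proof.
rewrite !ler_norml => /andP[? ?] /andP[? ?].
by case: (leP a b) => ?; case: (leP c d) => ?; apply/andP; split; lra.
Qed.

(** The intermediate value theorem in l, for the smaller of min Y and
    Y' 1 = W 1 + Q 1 * Y 1: it is positive when l is very negative and, by the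
    Riccati equation, at most 0 when l = Q 1. *)
Lemma positive_eigenfunction Q : continuous Q ->
  exists l Y W, [/\ l <= Q 1, quasi_solution Q l Y W,
    forall x, 0 <= x -> x <= 1 -> 0 < Y x & W 1 + Q 1 * Y 1 = 0].
Proof.
move=> Qc.
have [N N0 QN] := continuous_bounded ler01 (continuous_subspaceT Qc).
have /choice[Y /choice[W S]] := fun l => quasi_solution_exists l Qc.
have Yc l := quasi_solution_continuous (S l).
have /choice[c Hc] : forall l, exists c, [/\ 0 <= c, c <= 1 &
    forall x, 0 <= x -> x <= 1 -> Y l c <= Y l x].
  move=> l; have [c] := EVT_min ler01 (Yc l).
  rewrite in_itv/= => /andP[c0 c1] Hc; exists c; split => // x x0 x1.
  by apply: Hc; rewrite in_itv/= x0.
pose Z l := W l 1 + Q 1 * Y l 1.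
(* c l is a point where Y l is minimal, and Z l is the derivative of Y l at 1. *)
pose F l := Num.min (Y l (c l)) (Z l).
(* The bound of [quasi_solution_very_negative]. *)
pose b := 4 * N ^+ 2 + (N + 1) * expR (2 * N).
have b0 : 0 <= b.
  by rewrite addr_ge0 ?mulr_ge0 ?exprn_ge0 ?expR_ge0 ?addr_ge0.
pose a := Num.min (- b) (Q 1).
have aQ : a <= Q 1 by rewrite /a ge_min lexx orbT.
have Fa : 0 < F a.
  have [] := quasi_solution_very_negative QN (S a).
    by rewrite -/b lerNr /a ge_min lexx.
  move=> Ya Za; have [c0 c1 _] := Hc a.
  by rewrite /F lt_min Ya.
have FQ : F (Q 1) <= 0.
  rewrite /F ge_min -implyNb; apply/implyP; rewrite -ltNge => Yc0.
  have Ypos x : 0 <= x -> x <= 1 -> 0 < Y (Q 1) x.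
    by move=> x0 x1; apply: lt_le_trans Yc0 _; have [_ _] := Hc (Q 1); exact.
  have := riccati_le (S (Q 1)) Ypos (lexx 0) ler01 (lexx 1).
  have [_ -> _ _] := S (Q 1); rewrite mul0r !subr0 mulr1.
  by rewrite ler_pdivrMr ?Ypos// => ?; rewrite /Z; lra.
have Fc : {within `[a, Q 1], continuous F}.
  pose L := `|a| + `|Q 1|.
  have [K K0 HK] := @quasi_solution_lipschitz Q N L QN.
  apply: abs_continuous_continuous.
  apply: (@lipschitz_abs_continuous _ _ _ _ (K + N * K)) => l m al lm mQ.
  have lL : `|l| <= L.
    have := ler_norm (- a); have := ler_norm (Q 1); rewrite normrN /L => *.
    have := normr_ge0 a; have := normr_ge0 (Q 1); rewrite ler_norml => *.
    by apply/andP; split; lra.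
  have mL : `|m| <= L.
    have := ler_norm (- a); have := ler_norm (Q 1); rewrite normrN /L => *.
    have := normr_ge0 a; have := normr_ge0 (Q 1); rewrite ler_norml => *.
    by apply/andP; split; lra.
  have {}HK x : 0 <= x -> x <= 1 -> `|Y m x - Y l x| <= K * (m - l) /\
      `|W m x - W l x| <= K * (m - l).
    have -> : m - l = `|m - l| by rewrite ger0_norm// subr_ge0.
    exact: HK.
  have Kml : 0 <= K * (m - l) by rewrite mulr_ge0// subr_ge0.
  have NKml : 0 <= N * (K * (m - l)) by rewrite mulr_ge0.
  apply: ler_norm_minB.
    have [cl0 cl1 cl] := Hc l; have [cm0 cm1 cm] := Hc m.
    have [+ _] := HK _ cl0 cl1; have [+ _] := HK _ cm0 cm1.
    have := cl _ cm0 cm1; have := cm _ cl0 cl1.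
    by rewrite !ler_norml => ? ? /andP[? ?] /andP[? ?]; apply/andP; split; lra.
  have [HY HW] := HK 1 ler01 (lexx _).
  have -> : Z m - Z l = (W m 1 - W l 1) + Q 1 * (Y m 1 - Y l 1) by rewrite /Z; ring.
  rewrite (le_trans (ler_normD _ _))// mulrDl lerD// normrM -mulrA ler_pM//.
  exact: QN.
have [|l] := @IVT _ F a (Q 1) 0 aQ Fc.
  by rewrite ge_min FQ orbT/= le_max (ltW Fa).
rewrite in_itv/= => /andP[al lQ] Fl.
have [c0 c1 Ymin] := Hc l.
have Yc_ge0 : 0 <= Y l (c l) by rewrite -Fl /F ge_min lexx.
have Z_ge0 : 0 <= Z l by rewrite -Fl /F ge_min lexx orbT.
have Yc_gt0 : 0 < Y l (c l).
  rewrite lt_neqAle Yc_ge0 andbT eq_sym; apply/eqP => Yc0.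
  have [Y0 _ dY _] := S l.
  have Wc := quasi_solution_neq0 QN (S l) c0 c1 Yc0.
  (* At the zero c l the derivative of Y l is W l (c l); minimality on the left
     makes it nonpositive, and minimality on the right, or Z l >= 0 when
     c l = 1, makes it nonnegative. *)
  have c_gt0 : 0 < c l.
    rewrite lt_neqAle c0 andbT eq_sym; apply/eqP => cl0.
    by move: Yc0; rewrite cl0 Y0 => /eqP; rewrite oner_eq0.
  have := dY _ c0 c1; rewrite Yc0 mulr0 addr0 => dc.
  have Wc_le0 : W l (c l) <= 0.
    apply: (derive_left_min c_gt0 dc) => z z0 zc.
    by apply: Ymin => //; exact: le_trans c1.
  apply: Wc; apply/eqP; rewrite eq_le Wc_le0/=.
  have [cl1|] := ltP (c l) 1.
    apply: (derive_right_min cl1 dc) => z zc z1.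
    by apply: Ymin => //; exact: le_trans zc.
  move=> c_ge1; have cl1 : c l = 1 by apply/eqP; rewrite eq_le c1.
  by move: Z_ge0; rewrite /Z -cl1 Yc0 mulr0 addr0.
exists l, (Y l), (W l); split => //.
  by move=> x x0 x1; apply: lt_le_trans (Ymin x x0 x1).
by move: Fl; rewrite /F -/(Z l); case: leP => // _ Y0; move: Yc_gt0; rewrite Y0 ltxx.
Qed.

End PositiveEigenfunction.

(** * Potentials whose mean is at most every eigenvalue *)

Section MeanBelowSpectrum.
Context {R : realType}.
Implicit Types (q f Y W : R -> R) (x l a b : R).
Local Notation mu := (@lebesgue_measure R).

Lemma derive_bounded_lipschitz f (df : R -> R) (M : R) a b :
  (forall x, a <= x -> x <= b -> has_derivative_in `[a, b] f x (df x)) ->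
  (forall x, a <= x -> x <= b -> `|df x| <= M) ->
  forall s t, a <= s -> s <= t -> t <= b -> `|f t - f s| <= M * (t - s).
Proof.
move=> fdf dfM s t as_ st tb.
have fc : {within `[s, t], continuous f}.
  apply: (@continuous_subspaceW _ _ _ `[a, b]%classic).
    by apply: subset_itv; rewrite bnd_simp.
  apply: (@has_derivative_in_continuous _ _ _ df) => x /=.
  by rewrite in_itv/= => /andP[]; exact: fdf.
have fd x : x \in `]s, t[ -> is_derive x 1 f (df x).
  rewrite in_itv/= => /andP[sx xt].
  have ax : a < x by exact: le_lt_trans sx.
  have xb : x < b by exact: lt_le_trans tb.
  by apply: (has_derivative_in_is_derive ax xb); apply: fdf; exact: ltW.
have [c] := MVT_segment st fd fc.
rewrite in_itv/= => /andP[sc ct] ->.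
rewrite normrM [`|t - s|]ger0_norm ?subr_ge0// ler_wpM2r ?subr_ge0//.
by apply: dfM; [exact: le_trans sc|exact: le_trans tb].
Qed.

(** The endpoints of an interval form a null set. *)
Lemma ae_itvoo_cc a b (P : R -> Prop) :
  {ae mu, forall x, a < x -> x < b -> P x} ->
  {ae mu, forall x, x \in `[a, b] -> P x}.
Proof.
have ae_neq c : {ae mu, forall x : R, x <> c}.
  exists [set c]; split => //; first exact: lebesgue_measure_set1.
  by move=> x /= /contrapT.
move=> H; have := ae_neq b; move: (ae_neq a) H.
apply: filterS3; first exact: (ae_filter_ringOfSetsType mu).
move=> x xa Px xb; rewrite in_itv/= => /andP[ax bx]; apply: Px.
- by rewrite lt_neqAle ax andbT eq_sym; apply/eqP.
- by rewrite lt_neqAle bx andbT; apply/eqP.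
Qed.

Section Potential.
Variable q : R -> R.
Hypothesis qi : mu.-integrable `[0, 1] (EFin \o q).

Let Q x := \int[mu]_(t in `[0, x]) q t.
Let Qc x := Q (clamp01 x).

Let Q_ac : abs_continuous 0 1 Q.
Proof. exact: abs_continuous_primitive. Qed.

Let Qc_cts : continuous Qc.
Proof. by apply: continuous_clamp01; exact: abs_continuous_continuous. Qed.

Let QcE x : 0 <= x -> x <= 1 -> Qc x = Q x.
Proof. by move=> x0 x1; rewrite /Qc clamp01_id. Qed.

(** Back to the equation: Y' = W + Q Y is absolutely continuous as a combination
    of Lipschitz functions and of Q, and wherever Q' = q the terms in Q cancel,
    which leaves Y'' = (q - l) Y. *)
Lemma quasi_solution_eigenvalue l Y W :
  quasi_solution Qc l Y W -> W 1 + Qc 1 * Y 1 = 0 -> neumann_eigenvalue q l.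
Proof.
move=> S Z1; have [Y0 W0 dY dW] := S.
have [N N0 QN] := continuous_bounded ler01 (abs_continuous_continuous Q_ac).
have QcN x : 0 <= x -> x <= 1 -> `|Qc x| <= N.
  by move=> x0 x1; rewrite QcE// QN.
have [M M0 YM] := continuous_bounded ler01 (quasi_solution_continuous S).
have [M' M'0 WM] := continuous_bounded ler01 (is_derive_itv_continuous dW).
have Y_ac : abs_continuous 0 1 Y.
  apply: (@lipschitz_abs_continuous _ _ _ _ (M' + N * M)).
  apply: (@derive_bounded_lipschitz _ (fun x => W x + Qc x * Y x)).
    by move=> x x0 x1; exact/is_derive_has_derivative_in/dY.
  move=> x x0 x1; rewrite (le_trans (ler_normD _ _))// lerD ?WM//.
  by rewrite normrM ler_pM ?QcN ?YM.
have W_ac : abs_continuous 0 1 W.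
  apply: (@lipschitz_abs_continuous _ _ _ _ ((`|l| + N ^+ 2) * M + N * M')).
  apply: (@derive_bounded_lipschitz _
    (fun x => - (l + Qc x ^+ 2) * Y x - Qc x * W x)).
    by move=> x x0 x1; exact/is_derive_has_derivative_in/dW.
  move=> x x0 x1; rewrite (le_trans (ler_normB _ _))// lerD//; last first.
    by rewrite normrM ler_pM ?QcN ?WM.
  rewrite normrM ler_pM ?YM// normrN (le_trans (ler_normD _ _))// lerD2l.
  by rewrite normrX lerXn2r ?nnegrE// QcN.
exists Y; last first.
  by exists 0; rewrite ?in_itv/= ?lexx ?ler01// Y0 oner_eq0.
(* Inside [0, 1] the clamped primitive Qc agrees with Q, and Q differentiates to
   q almost everywhere. *)
exists (fun x => W x + Q x * Y x), (fun x => (q x - l) * Y x); split.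
- move=> x; rewrite in_itv/= => /andP[x0 x1].
  by rewrite -QcE//; exact/is_derive_has_derivative_in/dY.
- apply: abs_continuousD => //; apply: (@abs_continuousM _ _ _ _ _ (N + M)) => //.
    by move=> x x0 x1; rewrite (le_trans (QN x x0 x1))// lerDl.
  by move=> x x0 x1; rewrite (le_trans (YM x x0 x1))// lerDr.
- apply: ae_itvoo_cc; have := primitive_ae_derive qi.
  apply: filterS; first exact: (ae_filter_ringOfSetsType mu).
  move=> x dQ x0 x1; split; last by ring.
  apply: is_derive_has_derivative_in.
  have x0' := ltW x0; have x1' := ltW x1.
  apply: (is_derive_eq (derD (dW x x0' x1') (derM (dQ x0 x1) (dY x x0' x1')))).
  by rewrite QcE// /Q; ring.
- by rewrite W0 /Q set_itv1 Rintegral_set1 mul0r addr0.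
- by rewrite -QcE.
Qed.

(** The positive eigenfunction has an eigenvalue at most Q 1, the mean of q. The
    assumption makes it equal to Q 1, so that Q is linear by [riccati_eq]. *)
Lemma eigenvalues_ge_mean_cst :
  (forall l, neumann_eigenvalue q l -> \int[mu]_(x in `[0, 1]) q x <= l) ->
  {ae mu, forall x, x \in `[0, 1] -> q x = \int[mu]_(t in `[0, 1]) q t}.
Proof.
move=> lam_ge.
have [l [Y [W [lQ S Ypos Z1]]]] := positive_eigenfunction Qc_cts.
have Q1E : Qc 1 = \int[mu]_(t in `[0, 1]) q t by rewrite QcE.
have {}lQ : l = Qc 1.
  apply/eqP; rewrite eq_le lQ Q1E/=; apply: lam_ge.
  exact: quasi_solution_eigenvalue S Z1.
have Qlin x : 0 < x -> x < 1 -> Q x = Qc 1 * x.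
  move=> x0 x1; rewrite -QcE ?ltW//.
  exact: (riccati_eq S Ypos lQ Z1).
rewrite -Q1E; apply: ae_itvoo_cc; have := primitive_ae_derive qi.
apply: filterS; first exact: (ae_filter_ringOfSetsType mu).
move=> x dQ x0 x1.
have d1 : is_derive x 1 (fun t => Qc 1 * t) (q x).
  apply: (@is_derive_eq_near _ Q _ _ _ (Num.min x (1 - x))); last exact: dQ.
    by rewrite lt_min x0 subr_gt0.
  move=> z; rewrite lt_min => /andP[/ltr_normlP[z1 z2] /ltr_normlP[z3 z4]].
  by apply: Qlin; lra.
have d2 := derZ (Qc 1) (der_id x).
by rewrite -[LHS](@derive_val _ _ _ _ _ _ _ d1) (@derive_val _ _ _ _ _ _ _ d2) mulr1.
Qed.

End Potential.
End MeanBelowSpectrum.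

(** * Eigenfunctions for a large eigenvalue k ^ 2 *)

Section LargeEigenvalues.
Context {R : realType}.
Implicit Types (q f g y : R -> R) (x k M : R).
Local Notation mu := (@lebesgue_measure R).

Lemma integrable_mul_continuous q g : mu.-integrable `[0, 1] (EFin \o q) ->
  {within `[0, 1], continuous g} ->
  mu.-integrable `[0, 1] (EFin \o (fun x => q x * g x)).
Proof.
move=> qi gc.
have [M M0 gM] := continuous_bounded ler01 gc.
have : mu.-integrable `[0, 1] ((EFin \o q) \* (EFin \o g))%E.
  apply: integrableMl => //; first exact: subspace_continuous_measurable_fun.
  exists M; split; first exact: num_real.
  move=> z Mz x /=; rewrite in_itv/= => /andP[x0 x1].
  by rewrite (le_trans (gM x x0 x1))// ltW.
by apply: eq_integrable => // x _ /=; rewrite EFinM.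
Qed.

Lemma norm_Rintegral_mul_le q g M x : mu.-integrable `[0, 1] (EFin \o q) ->
  {within `[0, 1], continuous g} ->
  (forall t, 0 <= t -> t <= 1 -> `|g t| <= M) -> x <= 1 ->
  `|\int[mu]_(t in `[0, x]) (q t * g t)| <= M * \int[mu]_(t in `[0, 1]) `|q t|.
Proof.
move=> qi gc gM x1.
have sub : [set` `[0, x]] `<=` [set` `[0, (1 : R)]].
  by apply: subset_itvl; rewrite bnd_simp.
have qgi := integrable_mul_continuous qi gc.
have nqi : mu.-integrable `[0, 1] (EFin \o (fun t => `|q t|)).
  have := integrable_norm qi.
  by apply: eq_integrable.
have nqgi : mu.-integrable `[0, 1] (EFin \o (fun t => `|q t * g t|)).
  have := integrable_norm qgi.
  by apply: eq_integrable.
apply: (@le_trans _ _ (\int[mu]_(t in `[0, x]) `|q t * g t|)).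
  by apply: le_normr_Rintegral => //; exact: integrableS qgi.
apply: (@le_trans _ _ (\int[mu]_(t in `[0, 1]) `|q t * g t|)).
  rewrite /Rintegral fine_le//.
  - by apply: integrable_fin_num => //; exact: integrableS nqgi.
  - exact: integrable_fin_num.
  - apply: ge0_subset_integral => //.
    by have /integrableP[] := nqgi.
rewrite -RintegralZl//; apply: le_Rintegral => //.
  have : mu.-integrable `[0, 1] (fun t => M%:E * (EFin \o (fun t => `|q t|)%R) t)%E.
    exact: integrableZl.
  by apply: eq_integrable.
move=> t; rewrite /= in_itv/= => /andP[t0 t1].
by rewrite normrM mulrC ler_wpM2r// gM.
Qed.

Lemma der_cos k x : is_derive x 1 (fun t => cos (k * t)) (- k * sin (k * x)).
Proof.
have := der_comp (is_derive_cos (k * x)) (derZ k (der_id x)).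
by rewrite mulr1 mulrC mulrN mulNr.
Qed.

Lemma der_sin k x : is_derive x 1 (fun t => sin (k * t)) (k * cos (k * x)).
Proof.
have := der_comp (is_derive_sin (k * x)) (derZ k (der_id x)).
by rewrite mulr1 mulrC.
Qed.

Lemma cos_lipschitz k x z : 0 <= k -> x <= z ->
  `|cos (k * z) - cos (k * x)| <= k * (z - x).
Proof.
move=> k0 xz; rewrite mulrBr.
apply: (@derive_norm_le _ (fun t => cos (k * t)) (fun t => k * t)
  (fun t => - k * sin (k * t)) (fun t => k * 1)) => //.
- by move=> t _ _; exact: der_cos.
- move=> t _ _; rewrite mulr1 normrM normrN (ger0_norm k0) ler_piMr//.
  by rewrite ler_norml sin_geN1 sin_le1.
Qed.

Lemma sin_lipschitz k x z : 0 <= k -> x <= z ->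
  `|sin (k * z) - sin (k * x)| <= k * (z - x).
Proof.
move=> k0 xz; rewrite mulrBr.
apply: (@derive_norm_le _ (fun t => sin (k * t)) (fun t => k * t)
  (fun t => k * cos (k * t)) (fun t => k * 1)) => //.
- by move=> t _ _; exact: der_sin.
- move=> t _ _; rewrite mulr1 normrM (ger0_norm k0) ler_piMr//.
  by rewrite ler_norml cos_geN1 cos_le1.
Qed.

Section Asymptotics.
Variable q : R -> R.
Hypothesis qi : mu.-integrable `[0, 1] (EFin \o q).

Let nq := \int[mu]_(t in `[0, 1]) `|q t|.

Let nq0 : 0 <= nq.
Proof. by apply: Rintegral_ge0 => x _. Qed.

Let trig_continuous k : continuous (fun t => cos (k * t)) /\
  continuous (fun t => sin (k * t)).
Proof.
split=> t; apply: differentiable_continuous; apply/derivable1_diffP.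
  by have [] := der_cos k t.
by have [] := der_sin k t.
Qed.

Let norm_cos_le (u : R) : `|cos u| <= 1.
Proof. by rewrite ler_norml cos_geN1 cos_le1. Qed.

Let norm_sin_le (u : R) : `|sin u| <= 1.
Proof. by rewrite ler_norml sin_geN1 sin_le1. Qed.

(** The two left-hand sides are k times the amplitudes of cos (k x) and
    sin (k x) in y. Their derivatives do not contain y', and equal
    - q y sin (k x) and q y cos (k x). *)
Lemma neumann_variation_of_constants k y dy ddy : 0 <= k ->
  (forall x, x \in `[0, 1] -> has_derivative_in `[0, 1] y x (dy x)) ->
  abs_continuous 0 1 dy ->
  {ae mu, forall x, x \in `[0, 1] -> has_derivative_in `[0, 1] dy x (ddy x) /\
    - ddy x + q x * y x = k ^+ 2 * y x} ->
  dy 0 = 0 -> forall x, 0 <= x -> x <= 1 ->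
  k * y x * cos (k * x) - dy x * sin (k * x) =
    k * y 0 - \int[mu]_(t in `[0, x]) (q t * (y t * sin (k * t))) /\
  k * y x * sin (k * x) + dy x * cos (k * x) =
    \int[mu]_(t in `[0, x]) (q t * (y t * cos (k * t))).
Proof.
move=> k0 ydy dy_ac ode dy0.
have yc : {within `[0, 1], continuous y}.
  by apply: (@has_derivative_in_continuous _ _ _ dy) => x; exact: ydy.
have [M M0 yM] := continuous_bounded ler01 yc.
have [M' M'0 dyM] := continuous_bounded ler01 (abs_continuous_continuous dy_ac).
have y_ac : abs_continuous 0 1 y.
  apply: (@lipschitz_abs_continuous _ _ _ _ M').
  apply: (@derive_bounded_lipschitz _ _ dy) => // x x0 x1.
  by apply: ydy; rewrite in_itv/= x0.
have cos_ac : abs_continuous 0 1 (fun t => cos (k * t)).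
  by apply: (@lipschitz_abs_continuous _ _ _ _ k) => s t _ st _; exact: cos_lipschitz.
have sin_ac : abs_continuous 0 1 (fun t => sin (k * t)).
  by apply: (@lipschitz_abs_continuous _ _ _ _ k) => s t _ st _; exact: sin_lipschitz.
pose L := 1 + k * M + M' + 1.
have [kM0 LE] : 0 <= k * M /\ L = 1 + k * M + M' + 1 by rewrite mulr_ge0.
have cosL (t : R) : 0 <= t -> t <= 1 -> `|cos (k * t)| <= L.
  by move=> _ _; have := norm_cos_le (k * t); lra.
have sinL (t : R) : 0 <= t -> t <= 1 -> `|sin (k * t)| <= L.
  by move=> _ _; have := norm_sin_le (k * t); lra.
have kyL (t : R) : 0 <= t -> t <= 1 -> `|k * y t| <= L.
  move=> t0 t1; have := ler_wpM2l k0 (yM t t0 t1).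
  by rewrite normrM (ger0_norm k0); lra.
have dyL (t : R) : 0 <= t -> t <= 1 -> `|dy t| <= L.
  by move=> t0 t1; have := dyM t t0 t1; lra.
have ndyL (t : R) : 0 <= t -> t <= 1 -> `|- dy t| <= L.
  by move=> t0 t1; rewrite normrN dyL.
have cst_ac (c : R) : abs_continuous 0 1 (fun=> c).
  by apply: (@lipschitz_abs_continuous _ _ _ _ 0) => *; rewrite subrr normr0 mul0r.
have ky_ac : abs_continuous 0 1 (fun t => k * y t).
  apply: (@abs_continuousM _ _ _ _ _ (k + M)) => // t t0 t1.
    by rewrite ger0_norm// lerDl.
  by rewrite (le_trans (yM t t0 t1))// lerDr.
have ndy_ac : abs_continuous 0 1 (fun t => - dy t).
  have -> : (fun t => - dy t) = (fun t => -1 * dy t).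
    by apply/funext => t; rewrite mulN1r.
  apply: (@abs_continuousM _ _ _ _ _ (1 + M')) => // t t0 t1.
    by rewrite normrN1 lerDl.
  by rewrite (le_trans (dyM t t0 t1))// lerDr.
have [cc sc] := trig_continuous k.
have ysc : {within `[0, 1], continuous (fun t => y t * sin (k * t))}.
  by move=> t; apply: continuousM; [exact: yc|exact: (continuous_subspaceT sc)].
have ycc : {within `[0, 1], continuous (fun t => y t * cos (k * t))}.
  by move=> t; apply: continuousM; [exact: yc|exact: (continuous_subspaceT cc)].
have qysi := integrable_mul_continuous qi ysc.
have qyci := integrable_mul_continuous qi ycc.
have ode' : {ae mu, forall x, 0 < x -> x < 1 ->
    [/\ is_derive x 1 y (dy x), is_derive x 1 dy (ddy x) &
        ddy x = q x * y x - k ^+ 2 * y x]}.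
  move: ode; apply: filterS; first exact: (ae_filter_ringOfSetsType mu).
  move=> x H x0 x1; have xI : x \in `[0, 1] by rewrite in_itv/= !ltW.
  have [dd eq] := H xI; split; last by lra.
    exact: has_derivative_in_is_derive (ydy _ xI).
  exact: has_derivative_in_is_derive dd.
move=> x x0 x1; split.
- have := @abs_continuous_FTC _ (fun t => k * y t * cos (k * t) + - dy t * sin (k * t))
    (fun t => -1 * (q t * (y t * sin (k * t)))) 0 1 ler01 _ _ _ x x0 x1.
  rewrite !mulr0 cos0 sin0 !mulr1 mulr0 addr0 RintegralZl//; last first.
    apply: integrableS qysi => //; apply: subset_itvl; rewrite bnd_simp//.
  rewrite mulN1r mulNr; apply.
  + by apply: abs_continuousD; apply: (@abs_continuousM _ _ _ _ _ L).
  + have : mu.-integrable `[0, 1]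
        (fun t => (-1)%:E * (EFin \o (fun t => q t * (y t * sin (k * t)))%R) t)%E.
      exact: integrableZl.
    by apply: eq_integrable.
  + move: ode'; apply: filterS; first exact: (ae_filter_ringOfSetsType mu).
    move=> t H t0 t1; have [d1 d2 eq] := H t0 t1.
    apply: (is_derive_eq (derD (derM (derZ k d1) (der_cos k t))
                              (derM (derN d2) (der_sin k t)))).
    by rewrite eq; ring.
- have := @abs_continuous_FTC _ (fun t => k * y t * sin (k * t) + dy t * cos (k * t))
    (fun t => q t * (y t * cos (k * t))) 0 1 ler01 _ _ _ x x0 x1.
  rewrite !mulr0 cos0 sin0 mulr0 dy0 mul0r !add0r; apply => //.
  + by apply: abs_continuousD; apply: (@abs_continuousM _ _ _ _ _ L).
  + move: ode'; apply: filterS; first exact: (ae_filter_ringOfSetsType mu).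
    move=> t H t0 t1; have [d1 d2 eq] := H t0 t1.
    apply: (is_derive_eq (derD (derM (derZ k d1) (der_sin k t))
                             (derM d2 (der_cos k t)))).
    by rewrite eq; ring.
Qed.

(** Up to the factor k, the amplitudes vary by at most M |q|_1, where M is the
    maximum of |y|; for k >= 4 |q|_1 this gives M <= 2 |y 0|, so that k y is
    within 4 |y 0| |q|_1 of k y 0 cos (k x). The boundary condition at 1 says
    that the integral of q y cos (k x) is 0, and replacing y by y 0 cos (k x) in
    it gives the bound. *)
Lemma neumann_cos_sq_le k : 0 < k -> sin k = 0 -> 4 * nq <= k ->
  neumann_eigenvalue q (k ^+ 2) ->
  `|\int[mu]_(t in `[0, 1]) (q t * cos (k * t) ^+ 2)| <= 4 * nq ^+ 2 / k.
Proof.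
move=> k_gt0 sink nqk [y [dy [ddy [ydy dy_ac ode dy0 dy1]]] [x0 x0I yx0]].
have k0 := ltW k_gt0.
have H := neumann_variation_of_constants k0 ydy dy_ac ode dy0.
have yc : {within `[0, 1], continuous y}.
  by apply: (@has_derivative_in_continuous _ _ _ dy) => x; exact: ydy.
have [cc sc] := trig_continuous k.
have ysc : {within `[0, 1], continuous (fun t => y t * sin (k * t))}.
  by move=> t; apply: continuousM; [exact: yc|exact: (continuous_subspaceT sc)].
have ycc : {within `[0, 1], continuous (fun t => y t * cos (k * t))}.
  by move=> t; apply: continuousM; [exact: yc|exact: (continuous_subspaceT cc)].
have nyc : {within `[0, 1], continuous (fun t => `|y t|)}.
  by move=> t; apply: continuous_comp; [exact: yc|exact: norm_continuous].
have [c] := EVT_max ler01 nyc; rewrite in_itv/= => /andP[c0 c1] yM.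
pose M := `|y c|.
have {}yM t : 0 <= t -> t <= 1 -> `|y t| <= M.
  by move=> t0 t1; apply: yM; rewrite in_itv/= t0.
have M_gt0 : 0 < M.
  move: x0I; rewrite in_itv/= => /andP[? ?].
  by apply: lt_le_trans (yM x0 _ _) => //; rewrite normr_gt0.
have mulM (t u : R) : 0 <= t -> t <= 1 -> `|u| <= 1 -> `|y t * u| <= M.
  by move=> t0 t1 u1; rewrite normrM -[M]mulr1 ler_pM// yM.
have close x : 0 <= x -> x <= 1 -> `|k * y x - k * y 0 * cos (k * x)| <= 2 * M * nq.
  move=> x_ge0 x1; have [HA HB] := H x x_ge0 x1.
  have Is : `|\int[mu]_(t in `[0, x]) (q t * (y t * sin (k * t)))| <= M * nq.
    by apply: norm_Rintegral_mul_le => // t t0 t1; exact: mulM.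
  have Ic : `|\int[mu]_(t in `[0, x]) (q t * (y t * cos (k * t)))| <= M * nq.
    by apply: norm_Rintegral_mul_le => // t t0 t1; exact: mulM.
  have -> : k * y x - k * y 0 * cos (k * x) =
      (k * y x * cos (k * x) - dy x * sin (k * x) - k * y 0) * cos (k * x) +
      (k * y x * sin (k * x) + dy x * cos (k * x)) * sin (k * x).
    rewrite -[k * y x in LHS]mulr1 -(cos2Dsin2 (k * x)); ring.
  rewrite HA HB [X in X * _](_ : _ =
    - \int[mu]_(t in `[0, x]) (q t * (y t * sin (k * t)))); last by ring.
  rewrite (le_trans (ler_normD _ _))// !normrM normrN.
  have -> : 2 * M * nq = M * nq * 1 + M * nq * 1 by ring.
  by rewrite lerD// ler_pM.
have Mnq0 : 0 <= M * nq by rewrite mulr_ge0// ltW.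
have My0 : M <= 2 * `|y 0|.
  have : k * M <= k * `|y 0| + 2 * M * nq.
    have -> : k * M = `|k * y c| by rewrite normrM (ger0_norm k0).
    rewrite -[k * y c](subrK (k * y 0 * cos (k * c))) addrC.
    rewrite (le_trans (ler_normD _ _))// lerD ?close//.
    by rewrite !normrM (ger0_norm k0) ler_piMr// mulr_ge0.
  have : 4 * (M * nq) <= M * k by rewrite mulrCA ler_wpM2l// ltW.
  move=> h1 h2; rewrite -(ler_pM2l k_gt0); lra.
have y0 : 0 < `|y 0| by lra.
have [_] := H 1 ler01 (lexx _).
rewrite mulr1 sink mulr0 add0r dy1 mul0r => /esym I0.
pose g t := k * y t - k * y 0 * cos (k * t).
have gc : {within `[0, 1], continuous g}.
  rewrite /g => t; apply: cvgB; apply: cvgM.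
  - exact: cvg_cst.
  - exact: yc.
  - exact: cvg_cst.
  - exact: (continuous_subspaceT cc).
have gcc : {within `[0, 1], continuous (fun t => g t * cos (k * t))}.
  by move=> t; apply: continuousM; [exact: gc|exact: (continuous_subspaceT cc)].
have c2c : {within `[0, 1], continuous (fun t => cos (k * t) ^+ 2)}.
  by move=> t; apply: continuousM; exact: (continuous_subspaceT cc).
have Ig : `|\int[mu]_(t in `[0, 1]) (q t * (g t * cos (k * t)))| <= 2 * M * nq * nq.
  apply: norm_Rintegral_mul_le => // t t0 t1.
  by rewrite normrM -[leRHS]mulr1 ler_pM ?close.
have E : \int[mu]_(t in `[0, 1]) (q t * (g t * cos (k * t))) =
    - (k * y 0 * \int[mu]_(t in `[0, 1]) (q t * cos (k * t) ^+ 2)).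
  have qyci := integrable_mul_continuous qi ycc.
  have qc2i := integrable_mul_continuous qi c2c.
  have i1 : mu.-integrable `[0, 1]
      (EFin \o (fun t => k * (q t * (y t * cos (k * t))))).
    have : mu.-integrable `[0, 1]
        (fun t => k%:E * (EFin \o (fun t => q t * (y t * cos (k * t)))%R) t)%E.
      exact: integrableZl.
    by apply: eq_integrable.
  have i2 : mu.-integrable `[0, 1]
      (EFin \o (fun t => k * y 0 * (q t * cos (k * t) ^+ 2))).
    have : mu.-integrable `[0, 1]
        (fun t => (k * y 0)%:E * (EFin \o (fun t => q t * cos (k * t) ^+ 2)%R) t)%E.
      exact: integrableZl.
    by apply: eq_integrable.
  transitivity (\int[mu]_(t in `[0, 1]) (k * (q t * (y t * cos (k * t))) -
      k * y 0 * (q t * cos (k * t) ^+ 2))).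
    by apply: eq_Rintegral => t _; rewrite /g; ring.
  by rewrite RintegralB// RintegralZl// RintegralZl// I0 mulr0 sub0r.
move: Ig; rewrite E normrN !normrM (ger0_norm k0).
rewrite ler_pdivlMr// => Ig.
rewrite -(ler_pM2l y0).
have : M * (nq * nq) <= 2 * `|y 0| * (nq * nq) by rewrite ler_wpM2r// mulr_ge0.
move=> h; rewrite expr2.
by lra.
Qed.

End Asymptotics.
End LargeEigenvalues.

(** * Averages of squared cosines *)

Section MeanCos.
Context {R : realType}.
Implicit Types (t x : R).

(** The Dirichlet kernel, in the form
    4 sin t cos ^ 2 (n t) = 2 sin t + sin ((2 n + 1) t) - sin ((2 n - 1) t). *)
Lemma sum_cos_sq t n : 4 * sin t * (\sum_(i < n) cos (i%:R * t) ^+ 2) =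
  2 * n%:R * sin t + sin (2 * n%:R * t - t) + sin t.
Proof.
elim: n => [|n IH].
  by rewrite big_ord0 !(mulr0, mul0r) sub0r sinN add0r addNr.
rewrite big_ord_recr/= mulrDr IH; set a := n%:R * t.
have -> : 2 * n%:R * t - t = a *+ 2 - t by rewrite /a -mulr_natl; ring.
have -> : 2 * n.+1%:R * t - t = a *+ 2 + t.
  by rewrite /a -mulr_natl -(natr1 n); ring.
rewrite (sinB (a *+ 2)) (sinD (a *+ 2)) cos_mulr2n -(natr1 n); ring.
Qed.

Lemma mean_cos_sq_cvg t : 0 < t -> t < pi ->
  n.+1%:R^-1 * (\sum_(i < n.+1) cos (i%:R * t) ^+ 2) @[n --> \oo] --> (2^-1 : R).
Proof.
move=> t0 tpi; have s0 : 0 < sin t by rewrite sin_gt0_pi// t0.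
have H n : `|n.+1%:R^-1 * (\sum_(i < n.+1) cos (i%:R * t) ^+ 2) - 2^-1| <=
    n.+1%:R^-1 * (2 * sin t)^-1.
  have n0 : 0 < n.+1%:R :> R by rewrite ltr0n.
  have -> : n.+1%:R^-1 * (\sum_(i < n.+1) cos (i%:R * t) ^+ 2) - 2^-1 =
    n.+1%:R^-1 * (4 * sin t)^-1 *
    (4 * sin t * (\sum_(i < n.+1) cos (i%:R * t) ^+ 2) - 2 * n.+1%:R * sin t).
    by field; rewrite !gt_eqF.
  rewrite sum_cos_sq normrM ger0_norm; last first.
    by rewrite mulr_ge0 ?invr_ge0// ltW// mulr_gt0.
  rewrite -[leLHS]mulrA ler_wpM2l ?invr_ge0 ?(ltW n0)//.
  rewrite [leLHS]mulrC ler_pdivrMr ?mulr_gt0//.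
  have -> : (2 * sin t)^-1 * (4 * sin t) = 2 by field; rewrite gt_eqF.
  set u := 2 * n.+1%:R * t - t.
  have -> : 2 * n.+1%:R * sin t + sin u + sin t - 2 * n.+1%:R * sin t = sin u + sin t.
    by ring.
  have := sin_le1 u; have := sin_geN1 u; have := sin_le1 t; have := sin_geN1 t.
  by rewrite ler_norml => *; apply/andP; split; lra.
apply/cvgrPdist_le => e e0.
have [N NB] : exists N : nat, (2 * sin t)^-1 / e < N%:R.
  exists (Num.bound ((2 * sin t)^-1 / e)); apply: archi_boundP.
  by rewrite divr_ge0 ?invr_ge0 ?mulr_ge0 ?ltW.
exists N => // n /= Nn; rewrite distrC (le_trans (H n))//.
rewrite [leLHS]mulrC ler_pdivrMr ?ltr0n// [leRHS]mulrC -ler_pdivrMr//.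
by rewrite (le_trans (ltW NB))// ler_nat ltnW.
Qed.

End MeanCos.

(** * Vanishing of the mean *)

Section MeanZero.
Context {R : realType}.
Local Notation mu := (@lebesgue_measure R).
Variable q : R -> R.
Hypothesis qi : mu.-integrable `[0, 1] (EFin \o q).

Let a (i : nat) := \int[mu]_(t in `[0, 1]) (q t * cos (i%:R * pi * t) ^+ 2).

Let s n (t : R) : R := \sum_(i < n) cos (i%:R * (pi * t)) ^+ 2.

Let s_cts n : {within `[0, 1], continuous (s n)}.
Proof.
apply: continuous_subspaceT; elim: n => [|n IH] t.
  by rewrite /s; under eq_fun do rewrite big_ord0; exact: cst_continuous.
rewrite /s; under eq_fun do rewrite big_ord_recr/=.
apply: cvgD; first exact: IH.
have cosc : {for t, continuous (fun t : R => cos (n%:R * (pi * t)))}.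
  apply: differentiable_continuous; apply/derivable1_diffP.
  under eq_fun do rewrite mulrA.
  by have [] := der_cos (n%:R * pi) t.
exact: (cvgM cosc cosc).
Qed.

Let int_s n : \int[mu]_(t in `[0, 1]) (q t * s n t) = \sum_(i < n) a i.
Proof.
elim: n => [|n IH].
  rewrite big_ord0 (@eq_Rintegral _ _ _ mu _ (fun=> 0)).
    by rewrite Rintegral_cst// mul0r.
  by move=> t _; rewrite /s big_ord0 mulr0.
rewrite big_ord_recr/= -IH /a -RintegralD//.
- by apply: eq_Rintegral => t _; rewrite /s big_ord_recr/= mulrDr mulrA.
- exact: (integrable_mul_continuous qi (@s_cts n)).
- apply: integrable_mul_continuous => //.
  apply: continuous_subspaceT => t.
  have cosc : {for t, continuous (fun t : R => cos (n%:R * pi * t))}.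
    apply: differentiable_continuous; apply/derivable1_diffP.
    by have [] := der_cos (n%:R * pi) t.
  exact: (cvgM cosc cosc).
Qed.

(** Dominated convergence: the averages of cos ^ 2 stay in [0, 1] and tend to
    1 / 2. *)
Let mean_a_cvg :
  arithmetic_mean a n @[n --> \oo] --> (\int[mu]_(t in `[0, 1]) q t) / 2.
Proof.
pose f n t := q t * (n.+1%:R^-1 * s n.+1 t).
have c_cts n : {within `[0, 1], continuous (fun t => n.+1%:R^-1 * s n.+1 t)}.
  by move=> t; apply: cvgM; [exact: cvg_cst|exact: s_cts].
have fi n : mu.-integrable `[0, 1] (EFin \o f n).
  exact: integrable_mul_continuous.
have hi : mu.-integrable `[0, 1] (EFin \o (fun t => q t / 2)).
  apply: integrable_mul_continuous => //.
  by apply: continuous_subspaceT; exact: cst_continuous.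
have f_cvg : {ae mu, forall x, `[0, 1]%classic x ->
    (EFin \o f n) x @[n --> \oo] --> (EFin \o (fun t => q t / 2)) x}.
  have : {ae mu, forall x, x \in `[0, 1] ->
      (EFin \o f n) x @[n --> \oo] --> (EFin \o (fun t => q t / 2)) x}.
    apply: ae_itvoo_cc; apply: aeW => x x0 x1.
    apply: cvg_EFin; first exact: nearW.
    apply: cvgM; first exact: cvg_cst.
    apply: mean_cos_sq_cvg; first by rewrite mulr_gt0 ?pi_gt0.
    by rewrite gtr_pMr ?pi_gt0.
  exact.
have f_le : {ae mu, forall x n, `[0, 1]%classic x ->
    (`|(EFin \o f n) x| <= `|(EFin \o q) x|)%E}.
  apply: aeW => x n _ /=; rewrite lee_fin normrM ler_piMr//.
  rewrite ger0_norm; last first.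
    by rewrite mulr_ge0 ?invr_ge0// sumr_ge0// => i _; exact: sqr_ge0.
  rewrite mulrC ler_pdivrMr ?ltr0n// mul1r.
  rewrite -[leRHS]mulr1 -[X in _ <= _%:R * X]/(1) mulr_natl -[X in _ *+ X]card_ord.
  rewrite -sumr_const; apply: ler_sum => i _.
  by rewrite cos2sin2 gerBl sqr_ge0.
have mI : measurable [set` `[0, (1 : R)]] by exact: measurable_itv.
have mf n : measurable_fun [set` `[0, (1 : R)]] (EFin \o f n).
  by have /integrableP[] := fi n.
have mh : measurable_fun [set` `[0, (1 : R)]] (EFin \o (fun t => q t / 2)).
  by have /integrableP[] := hi.
have [_ _] := @dominated_convergence _ _ _ mu _ mI _ _ _ mf mh f_cvg
  (integrable_norm qi) f_le.
rewrite -[X in _ --> X]fineK; last exact: integrable_fin_num.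
move=> /fine_cvg; rewrite -RintegralZr//; apply: cvg_trans.
apply: near_eq_cvg; apply: nearW => n.
rewrite /arithmetic_mean /series/= big_mkord -int_s -RintegralZl//; last first.
  by apply: integrable_mul_continuous => //; exact: s_cts.
rewrite -/(Rintegral _ _ _).
by apply: eq_Rintegral => t _; rewrite /f mulrCA.
Qed.

Let a_cvg0 (n0 : nat) :
  (forall n, (n0 < n)%N -> neumann_eigenvalue q ((n%:R * pi) ^+ 2)) ->
  a n @[n --> \oo] --> 0.
Proof.
move=> ev.
pose nq := \int[mu]_(t in `[0, 1]) `|q t|.
have nq0 : 0 <= nq by apply: Rintegral_ge0 => x _.
apply/cvgrPdist_le => e e0.
have b1 := archi_boundP (mulr_ge0 (ler0n R 4) nq0).
have b2 : 4 * nq ^+ 2 / e < (Num.bound (4 * nq ^+ 2 / e))%:R.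
  by apply: archi_boundP; rewrite divr_ge0 ?mulr_ge0 ?exprn_ge0// ltW.
set N1 := Num.bound _ in b1; set N2 := Num.bound _ in b2.
(* n exceeds n0, 4 |q|_1 and 4 |q|_1 ^ 2 / e, and pi >= 1. *)
exists (n0 + N1 + N2).+1 => // n /= nN.
have n_gt0 : 0 < n%:R :> R by rewrite ltr0n; exact: leq_trans nN.
have npi : n%:R <= n%:R * pi :> R.
  by rewrite ler_peMr ?(ltW n_gt0)// (le_trans _ (pi_ge2 _))// ler1n.
have N1n : N1%:R <= n%:R :> R.
  by rewrite ler_nat (leq_trans _ nN)// leqW// addnAC leq_addl.
have N2n : N2%:R <= n%:R :> R.
  by rewrite ler_nat (leq_trans _ nN)// leqW// leq_addl.
have sinnpi : sin (n%:R * pi) = 0 :> R.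
  elim: n {nN n_gt0 npi N1n N2n} => [|n IH]; first by rewrite mul0r sin0.
  by rewrite -(natr1 n) mulrDl mul1r sinDpi IH oppr0.
rewrite sub0r normrN /a; apply: le_trans (neumann_cos_sq_le qi _ sinnpi _ _) _.
- exact: lt_le_trans npi.
- by rewrite (le_trans (ltW b1))// (le_trans N1n).
- by apply: ev; rewrite (leq_trans _ nN)// ltnS -addnA leq_addr.
have npi0 : 0 < n%:R * pi :> R by exact: lt_le_trans npi.
rewrite ler_pdivrMr// [leRHS]mulrC -ler_pdivrMr//.
by rewrite (le_trans (ltW b2))// (le_trans N2n).
Qed.

(** By [a_cvg0] the integrals a n of q cos ^ 2 (n pi t) tend to 0, hence so do
    their arithmetic means; by [mean_a_cvg] these tend to half of the mean of q. *)
Lemma mean_potential_eq0 (n0 : nat) :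
  (forall n, (n0 < n)%N -> neumann_eigenvalue q ((n%:R * pi) ^+ 2)) ->
  \int[mu]_(t in `[0, 1]) q t = 0.
Proof.
move=> /a_cvg0/cesaro a0.
have : \int[mu]_(t in `[0, 1]) q t / 2 = 0 :> R.
  exact: cvg_unique mean_a_cvg a0.
by move=> /eqP; rewrite mulf_eq0 invr_eq0 pnatr_eq0 orbF => /eqP.
Qed.

End MeanZero.

Theorem theorem5 (R : realType) (q : R -> R)
    (q_L1 : (@lebesgue_measure R).-integrable `[0, 1] (EFin \o q))
    (lam : nat -> R)
    (lam_increasing : forall m n : nat, (m < n)%N -> lam m < lam n)
    (lam_eigenvalues :
       range lam = [set mu : R | neumann_eigenvalue q mu]) :
  (\int[@lebesgue_measure R]_(x in `[0, 1]) q x <= lam 0%N ->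
     {ae (@lebesgue_measure R), forall x, x \in `[0, 1] ->
        q x = \int[@lebesgue_measure R]_(t in `[0, 1]) q t})
  /\
  (0 <= lam 0%N ->
     (exists2 n0 : nat, (0 < n0)%N &
        forall n : nat, (n0 < n)%N -> lam n = (n%:R * pi) ^+ 2) ->
     {ae (@lebesgue_measure R), forall x, x \in `[0, 1] -> q x = 0}).
Proof.
have eigen n : neumann_eigenvalue q (lam n).
  have : range lam (lam n) by exists n.
  by rewrite lam_eigenvalues.
have lam0_le l : neumann_eigenvalue q l -> lam 0%N <= l.
  move=> ql; have : [set l | neumann_eigenvalue q l] l by [].
  rewrite -lam_eigenvalues => -[[|n] _ <-] //.
  exact/ltW/lam_increasing.
have partA : \int[@lebesgue_measure R]_(x in `[0, 1]) q x <= lam 0%N ->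
    {ae (@lebesgue_measure R), forall x, x \in `[0, 1] ->
      q x = \int[@lebesgue_measure R]_(t in `[0, 1]) q t}.
  move=> mean_le; apply: eigenvalues_ge_mean_cst => // l /lam0_le.
  exact: le_trans.
split => // lam0 [n0 _ lamE].
have mean0 : \int[@lebesgue_measure R]_(t in `[0, 1]) q t = 0.
  apply: (@mean_potential_eq0 _ _ q_L1 n0) => n n0n.
  by rewrite -lamE.
by rewrite mean0 in partA; exact: partA.
Qed.
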